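(* Let $G$ be a unique product group and let $C$ be a finite subset of $G$ containing the identity element such that the subgroup $\langle C\rangle$ is not abelian. Then for all subsets $B$ of $G$ with $|B|\geq 7$, $|BC|\geq |B|+|C|+2$.
   Context: $|\cdot|$ denotes the cardinality of a finite set, so $B$ ranges over finite subsets of $G$. For subsets $B,C$ of a group $G$ (written multiplicatively), $BC=\{bc \mid b\in B,\ c\in C\}$. A group $G$ is a unique product group if for every pair of finite non-empty subsets $A,B\subseteq G$ there exists an element $x\in AB$ such that $|\{(a,b)\in A\times B \mid x=ab\}|=1$. *)

(* Defs.v *)
From mathcomp Require Import all_boot finmap.

Set Implicit Arguments.
Unset Strict Implicit.
Unset Printing Implicit Defensive.

Local Open Scope group_scope.
Local Open Scope fset_scope.

Section Defs.
Variable G : groupType.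

Definition prodset (B C : {fset G}) : {fset G} :=
  [fset b * c | b in B, c in C].

Definition unique_product_group : Prop :=
  forall A B : {fset G}, A != fset0 -> B != fset0 ->
  exists2 x, x \in prodset A B &
    #|` [fset p in A `*` B | x == p.1 * p.2]| = 1%N.

(* Subgroups are Prop-valued predicates: membership in a subgroup of an
   arbitrary group need not be decidable. *)
Definition subgroup (H : G -> Prop) : Prop :=
  [/\ H 1, forall x y, H x -> H y -> H (x * y) & forall x, H x -> H x^-1].

Definition generated (C : {fset G}) (x : G) : Prop :=
  forall H : G -> Prop, subgroup H -> (forall c, c \in C -> H c) -> H x.

Definition abelian_pred (H : G -> Prop) : Prop :=
  forall x y, H x -> H y -> commute x y.

End Defs.

(* Main.v *)
Require Import Defs.
From mathcomp Require Import all_boot finmap boolp zify.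

Set Implicit Arguments.
Unset Strict Implicit.
Unset Printing Implicit Defensive.

(** In a unique product group a set X can always be deprived of one element
    without increasing f(X) = |XC| - |X|. Hence |AC| >= |A| + |C| - 1, the group
    is torsion-free, and B may be assumed to have exactly 7 elements.

    Suppose C = D + {a} where D lies in a subgroup N normalized by a such that
    no positive power of a is in N. Sorting B into cosets of N and removing a coset
    tN with taN disjoint from B, one gets |B| <= g(g-1)/2 with g = f(B) - |D| + 2,
    so f(B) >= |C| + 2 as soon as |B| >= 7. This applies when a conjugates b into
    <b> and D is in <b>.

    Let C = {1, x, y} and f(B) <= 4. Then B contains 5 elements b_i, ordered so that
    each translate b_i C meets an earlier one, whose first k translates cover at most
    3, 5, 7, 8, 9 points. Every coincidence pattern yields closed walks
    b_i -> b_j -> ... -> b_i, that is, relations in x and y. An exhaustive search shows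
    that relations from walks of length at most 4 always force x and y to commute, or,
    after permuting the elements of C, x to conjugate y into <y>.

    For |C| >= 4, delete an element c occurring in a unique product. If the rest is
    abelian up to translation, generating H, then B meets at most two cosets of H,
    two only if |C| = 4; in the latter case C \ {c} is a progression with ratio q that c
    conjugates into <q>, up to translation, and the coset count applies again. *)

(** * Product sets in unique product groups *)

Section ProductSets.
Variable G : groupType.
Implicit Types (A B C D X Y : {fset G}) (a b c x y : G).
Local Open Scope group_scope.
Local Open Scope fset_scope.

Lemma prodsetP A B z :
  reflect (exists a b, [/\ a \in A, b \in B & z = a * b]) (z \in prodset A B).
Proof.
apply: (iffP (imfset2P _ _ _ _ _)) => [[a Aa [b Bb ->]]|[a [b [Aa Bb ->]]]].
  by exists a, b.
by exists a => //; exists b.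
Qed.

Lemma mem_prodset A B a b : a \in A -> b \in B -> a * b \in prodset A B.
Proof. by move=> Aa Bb; apply/prodsetP; exists a, b. Qed.

Lemma prodsetS A A' B B' :
  A `<=` A' -> B `<=` B' -> prodset A B `<=` prodset A' B'.
Proof.
move=> /fsubsetP sA /fsubsetP sB; apply/fsubsetP => _ /prodsetP[a [b [Aa Bb ->]]].
by rewrite mem_prodset ?sA ?sB.
Qed.

Lemma prodsetUl A A' B : prodset (A `|` A') B = prodset A B `|` prodset A' B.
Proof.
apply/fsetP => z; rewrite in_fsetU; apply/prodsetP/orP.
  case=> a [b [/fsetUP[] Aa Bb ->]]; [left|right]; exact: mem_prodset.
by case=> /prodsetP[a [b [Aa Bb ->]]]; exists a, b; rewrite in_fsetU Aa ?orbT.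
Qed.

Lemma prodsetUr A B B' : prodset A (B `|` B') = prodset A B `|` prodset A B'.
Proof.
apply/fsetP => z; rewrite in_fsetU; apply/prodsetP/orP.
  case=> a [b [Aa /fsetUP[] Bb ->]]; [left|right]; exact: mem_prodset.
by case=> /prodsetP[a [b [Aa Bb ->]]]; exists a, b; rewrite in_fsetU Bb ?orbT.
Qed.

Lemma prodset0l B : prodset fset0 B = fset0.
Proof. by apply/fsetP => z; rewrite in_fset0; apply/prodsetP => -[a [b []]]. Qed.

Lemma prodsetA A B C : prodset (prodset A B) C = prodset A (prodset B C).
Proof.
apply/fsetP => z; apply/prodsetP/prodsetP.
  case=> _ [c [/prodsetP[a [b [Aa Bb ->]]] Cc ->]].
  by exists a, (b * c); rewrite Aa mem_prodset // mulgA.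
case=> a [_ [Aa /prodsetP[b [c [Bb Cc ->]]] ->]].
by exists (a * b), c; rewrite Cc mem_prodset // mulgA.
Qed.

Lemma card_prodset1l a B : #|` prodset [fset a] B| = #|` B|.
Proof.
have <- : #|` [fset a * b | b in B]| = #|` B| by rewrite card_imfset //; exact: mulgI.
congr #|` _|; apply/fsetP => z; apply/prodsetP/imfsetP => [[_ [b [/fset1P-> Bb ->]]]|[b Bb ->]].
  by exists b.
by exists a, b; rewrite in_fset1 eqxx.
Qed.

Lemma card_prodset1r A b : #|` prodset A [fset b]| = #|` A|.
Proof.
have <- : #|` [fset a * b | a in A]| = #|` A| by rewrite card_imfset //; exact: mulIg.
congr #|` _|; apply/fsetP => z; apply/prodsetP/imfsetP => [[a [_ [Aa /fset1P-> ->]]]|[a Aa ->]].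
  by exists a.
by exists a, b; rewrite in_fset1 eqxx.
Qed.

Lemma card_fsetU_disjoint A B :
  (forall z, z \in A -> z \notin B) -> #|` A `|` B| = (#|` A| + #|` B|)%N.
Proof.
move=> AB; rewrite cardfsU; have -> : A `&` B = fset0.
  by apply/fsetP => z; rewrite !inE; case: (boolP (z \in A)) => // /AB/negPf->.
by rewrite cardfs0 subn0.
Qed.

End ProductSets.

(** * Consequences of the unique product property *)

Section UniqueProducts.
Variable G : groupType.
Hypothesis HG : unique_product_group G.
Implicit Types (A B C D X Y : {fset G}) (a b c x y : G).
Local Open Scope group_scope.
Local Open Scope fset_scope.

(** The form used below: a product with a single representation is lost as soon as either of its
    factors is deleted. *)
Lemma unique_product A B : A != fset0 -> B != fset0 ->
  exists a b, [/\ a \in A, b \in B, a * b \notin prodset (A `\ a) B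
                & a * b \notin prodset A (B `\ b)].
Proof.
move=> A0 B0; have [z _ /eqP/cardfs1P[[a b] E]] := HG A0 B0.
have U p : (p.1 \in A) && (p.2 \in B) && (z == p.1 * p.2) = (p == (a, b)).
  by have := congr1 (fun F : {fset G * G} => p \in F) E; rewrite !inE /=.
have := U (a, b); rewrite eqxx /= => /andP[/andP[Aa Bb] /eqP zE].
exists a, b; split=> //; apply/prodsetP => -[a' [b' [H1 H2 E']]].
- move: H1; rewrite !inE => /andP[a'a Aa'].
  have := U (a', b'); rewrite /= Aa' H2 zE E' eqxx /= => /esym/eqP[e _].
  by rewrite e eqxx in a'a.
- move: H2; rewrite !inE => /andP[b'b Bb'].
  have := U (a', b'); rewrite /= Bb' H1 zE E' eqxx /= => /esym/eqP[_ e].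
  by rewrite e eqxx in b'b.
Qed.

Lemma remove_left A C : A != fset0 -> C != fset0 ->
  exists2 a, a \in A & #|` prodset (A `\ a) C| < #|` prodset A C|.
Proof.
move=> A0 C0; have [a [c [Aa Cc N _]]] := unique_product A0 C0.
exists a => //; rewrite (cardfsD1 (a * c) (prodset A C)) mem_prodset //= add1n ltnS.
apply/fsubset_leq_card; rewrite fsubsetD1 N andbT.
by apply: prodsetS => //; exact: fsubD1set.
Qed.

(** Each deletion supplied by [remove_left] costs at least one product, and a single element leaves
    a translate of [C]. *)
Lemma card_prodset_ge A C : A != fset0 -> C != fset0 ->
  #|` A| + #|` C| <= #|` prodset A C| + 1.
Proof.
elim: {A}(#|` A|) {-2}A (erefl #|` A|) => [|n IH] A cA A0 C0.
  by move: A0; rewrite -cardfs_gt0 cA.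
have [a Aa lt] := remove_left A0 C0.
have cD : #|` A `\ a| = n by have := cardfsD1 a A; rewrite Aa cA; lia.
have [D0|D0] := eqVneq (A `\ a) fset0.
  have n0 : n = 0 by rewrite -cD D0 cardfs0.
  have : #|` prodset [fset a] C| <= #|` prodset A C|.
    by apply/fsubset_leq_card/prodsetS => //; rewrite fsub1set.
  rewrite card_prodset1l cA n0; lia.
have := IH _ cD D0 C0; rewrite ?cA; lia.
Qed.

(** This is |XC| - |X| <= |AC| - |A| written without truncated subtraction; deletions by
    [remove_left] preserve it. *)
Lemma shrink_left A C k : C != fset0 -> k <= #|` A| ->
  exists2 X, X `<=` A & #|` X| = k /\ #|` prodset X C| + #|` A| <= #|` prodset A C| + k.
Proof.
move=> C0; elim: {A}(#|` A|) {-2}A (erefl #|` A|) => [|n IH] A cA kA.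
  by exists A => //; lia.
have [kn|kn] := eqVneq k n.+1; first by exists A => //; lia.
have A0 : A != fset0 by rewrite -cardfs_gt0 cA.
have [a Aa lt] := remove_left A0 C0.
have cD : #|` A `\ a| = n by have := cardfsD1 a A; rewrite Aa cA; lia.
have [X sX [cX le]] := IH _ cD ltac:(lia).
exists X; first by apply: fsubset_trans sX _; exact: fsubD1set.
by split=> //; move: lt le; lia.
Qed.

(** The powers of [x] form a finite set closed under products, so 2|A| <= |A| + 1 and [A] is a
    singleton. *)
Lemma torsion_free x n : 0 < n -> x ^+ n = 1 -> x = 1.
Proof.
move=> n0 xn; pose A : {fset G} := [fset x ^+ i | i in iota 0 n].
have AP z : z \in A -> exists2 i, i < n & z = x ^+ i.
  by move/imfsetP => [i /=]; rewrite mem_iota => /andP[_ lt] ->; exists i.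
have inA i : x ^+ i \in A.
  rewrite (divn_eq i n) expgnDr mulnC expgnA xn expg1n mul1g.
  by apply/imfsetP; exists (i %% n) => //=; rewrite mem_iota ltn_mod.
have A0 : A != fset0 by apply/fset0Pn; exists (x ^+ 0); exact: inA.
have sub : prodset A A `<=` A.
  apply/fsubsetP => _ /prodsetP[a [b [/AP[i _ ->] /AP[j _ ->] ->]]].
  by rewrite -expgnDr inA.
have := card_prodset_ge A0 A0; have := fsubset_leq_card sub => le ge.
have c1 : #|` A| == 1%N by move: A0; rewrite -cardfs_gt0; lia.
have [z E] := cardfs1P _ c1.
have := inA 1%N; have := inA 0%N; rewrite E !in_fset1 => /eqP <- /eqP.
by rewrite expg1 expg0.
Qed.

End UniqueProducts.

(** * Counting by cosets *)

(** This and the next two inequalities are the arithmetic of [row_bound]: [q] is the size of the row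
    removed, [s] that of the remainder and [r] that of the top row of the remainder. Here the
    remainder is empty. *)
Lemma triangular_lt q g : q < g -> 2 * q + q * (q - 1) <= g * (g - 1).
Proof.
case: g => // g; case: q => // q; rewrite !subSS !subn0 => qg.
have := leq_mul qg (qg : q.+1 <= g). nia.
Qed.
Lemma triangular_add q g g' s r : 0 < q ->
  2 * s + r * (r - 1) <= g' * (g' - 1) -> g' + q + 1 <= g ->
  2 * (s + q) + q * (q - 1) <= g * (g - 1).
Proof.
case: q => // q _; case: g' => [|u]; case: g => // g; rewrite ?subSS ?subn0 => H le.
  have := leq_mul le (ltac:(lia) : q.+1 <= g); lia.
have := leq_mul le (ltac:(lia) : u.+1 + q.+1 <= g).
move: (r * _) H => ?; lia.
Qed.
Lemma triangular_step q g g' s r : 0 < q -> 0 < r -> r <= s ->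
  2 * s + r * (r - 1) <= g' * (g' - 1) ->
  g' + (q + 1 - r) <= g -> 2 * (s + q) + q * (q - 1) <= g * (g - 1).
Proof.
move=> q0 r0 rs H gg.
have rg : r < g'.
  rewrite ltnNge; apply/negP => le.
  have := leq_mul le (ltac:(lia) : g' - 1 <= r - 1); lia.
have mono : g' * (g' - 1) <= g * (g - 1) by apply: leq_mul; lia.
have [qr|qr] := ltnP q r.
  have := triangular_lt qr; lia.
have [k Ek] : exists k, q = (r + k)%N by exists (q - r)%N; lia.
subst q; have gg' : g' + k.+1 <= g by lia.
case: g' rg H gg' {gg mono} => // u rg H gg'.
case: r r0 rs rg H q0 qr => // r _ rs rg H _ _.
have := leq_mul gg' (ltac:(lia) : u + k.+1 <= g - 1).
have : k.+1 * r.+1 <= k.+1 * u by rewrite leq_mul2l; lia.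
have -> : (r.+1 + k - 1 = r + k)%N by lia.
move: H; rewrite !subn1 /= => H; lia.
Qed.

(** * Removing one coset of a normalized subgroup at a time *)

Section Rows.
Variable G : groupType.
Hypothesis HG : unique_product_group G.
Local Open Scope group_scope.
Local Open Scope fset_scope.
Variables (N : G -> Prop) (a : G) (D : {fset G}).
Hypothesis subN : subgroup N.
Hypothesis conjN : forall g, N g -> N (a^-1 * g * a).
Hypothesis conjNV : forall g, N g -> N (a * g * a^-1).
Hypothesis freeN : forall k, 0 < k -> ~ N (a ^+ k).
Hypothesis DN : forall d, d \in D -> N d.
Hypothesis D2 : 2 <= #|` D|.

Implicit Types (B T : {fset G}) (t x y z : G).

Let C := D `|` [fset a].
Definition row t B : {fset G} := [fset x in B | `[< N (t^-1 * x) >]].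
Definition top t B := forall x, x \in B -> ~ N ((t * a)^-1 * x).

Let N1 : N 1. Proof. by case: subN. Qed.
Let NM x y : N x -> N y -> N (x * y). Proof. by case: subN => _ + _; apply. Qed.
Let NV x : N x -> N x^-1. Proof. by case: subN => _ _; apply. Qed.

Lemma coset_sym x y : N (x^-1 * y) -> N (y^-1 * x).
Proof. by move/NV; rewrite invgM invgK. Qed.

Lemma coset_trans y x z : N (x^-1 * y) -> N (y^-1 * z) -> N (x^-1 * z).
Proof. by move=> xy /(NM xy); rewrite mulgA mulgK. Qed.

Lemma in_row t B x : reflect (x \in B /\ N (t^-1 * x)) (x \in row t B).
Proof.
by rewrite !inE /=; apply: (iffP andP) => -[Bx /asboolP H]; split=> //; apply/asboolP.
Qed.

Lemma a_notin_N : ~ N a.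
Proof. by have := @freeN 1 isT; rewrite expg1. Qed.

Let C0 : C != fset0.
Proof. by apply/fset0Pn; exists a; rewrite in_fsetU in_fset1 eqxx orbT. Qed.

Let cC : #|` C| = #|` D|.+1.
Proof.
rewrite card_fsetU_disjoint ?cardfs1 ?addn1 // => z /DN Nz.
by rewrite in_fset1; apply/eqP => E; apply: a_notin_N; rewrite -E.
Qed.

(** Otherwise every coset tN met by [B] is followed by a coset taN met by [B]; iterating in a finite
    set must repeat an element, which puts a positive power of [a] in [N]. *)
Lemma exists_top B : B != fset0 -> exists2 t, t \in B & top t B.
Proof.
move=> /fset0Pn[t0 Bt0]; apply: contrapT => noT.
have step t : exists x, t \in B -> x \in B /\ N ((t * a)^-1 * x).
  have [Bt|] := boolP (t \in B); last by exists t.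
  apply: contrapT => H; apply: noT; exists t => // x Bx Nx.
  by apply: H; exists x.
have [f fP] := choice step.
have fB k t : t \in B -> iter k f t \in B.
  by elim: k => //= k IH Bt; have [] := fP _ (IH Bt).
have fN k t : t \in B -> N ((t * a ^+ k)^-1 * iter k f t).
  elim: k => /= [Bt|k IH Bt]; first by rewrite expg0 mulg1 mulVg.
  have [_ H] := fP _ (fB k _ Bt).
  apply: coset_trans H; have := conjN (IH Bt).
  by rewrite expgSr !invgM !mulgA.
pose s := [seq iter i f t0 | i <- iota 0 #|` B|.+1].
have : ~~ uniq s.
  apply/negP => /uniq_leq_size => /(_ (enum_fset B)).
  rewrite size_map size_iota ltnn => H; suff : false by [].
  by apply: H => _ /mapP[i _ ->]; exact: fB.
case/(uniqPn t0) => i [j [ij]]; rewrite size_map size_iota => jB.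
rewrite !(nth_map 0%N) ?size_iota ?(ltn_trans ij) // !nth_iota ?(ltn_trans ij) // !add0n.
move=> E; have := fN (j - i)%N _ (fB i _ Bt0).
rewrite -iterD subnK ?(ltnW ij) // -E invgM mulgVK => /NV; rewrite invgK.
by apply: freeN; rewrite subn_gt0.
Qed.

(** Removing the row T loses all of Ta, which lies in taN where [B'] makes no product, and the part
    of TD outside Pa: in tN, the remainder can only produce elements of Pa. *)
Lemma row_step B t (T := row t B) (B' := B `\` T) (P := row (t * a^-1) B') :
  t \in B -> top t B ->
  #|` prodset B' C| + #|` T| + (#|` T| + #|` D| - 1 - #|` P|)
    <= #|` prodset B C|.
Proof.
move=> Bt topt.
have T0 : T != fset0.
  by apply/fset0Pn; exists t; apply/in_row; rewrite Bt mulVg.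
have D0 : D != fset0 by rewrite -cardfs_gt0; lia.
have TD := card_prodset_ge HG T0 D0.
pose Ta := prodset T [fset a]; pose Pa := prodset P [fset a].
have cTa : #|` Ta| = #|` T| by exact: card_prodset1r.
have cPa : #|` Pa| = #|` P| by exact: card_prodset1r.
have inTa z : z \in Ta -> N ((t * a)^-1 * z).
  move=> /prodsetP[x [_ [/in_row[Bx Nx] /fset1P-> ->]]].
  by have := conjN Nx; rewrite invgM !mulgA.
have inTD z : z \in prodset T D -> N (t^-1 * z).
  move=> /prodsetP[x [d [/in_row[Bx Nx] /DN Nd ->]]].
  by rewrite mulgA; apply: NM.
have inB' z : z \in prodset B' C ->
    (exists2 x, x \in B' & N (x^-1 * z)) \/ (exists2 x, x \in B' & z = x * a).
  move=> /prodsetP[x [c [B'x /fsetUP[/DN Nc|/fset1P->] ->]]].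
    by left; exists x => //; rewrite mulKg.
  by right; exists x.
have B'P x : x \in B' -> x \in B /\ ~ N (t^-1 * x).
  move=> /fsetDP[Bx nT]; split=> // Nx; move/negP: nT; apply.
  exact/in_row.
have dis1 z : z \in prodset B' C -> z \notin Ta.
  move=> /inB' H; apply/negP => /inTa Nz; case: H => -[x /B'P[Bx nN]].
    by move=> /coset_sym Nx; apply: (topt x Bx); apply: coset_trans Nx.
  move=> E; apply: nN; have := conjNV Nz.
  by rewrite E invgM !mulgA mulgK mulgV mul1g.
have dis2 z : z \in prodset B' C `|` Ta -> z \notin (prodset T D `\` Pa).
  move=> H; apply/negP => /fsetDP[/inTD Nz nPa].
  case/fsetUP: H => [/inB'[] [x B'x]|/inTa Nz'].
  - have [Bx nN] := B'P _ B'x => /coset_sym Nx.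
    by apply: nN; apply: coset_trans Nx.
  - move=> E; move/negP: nPa; apply; rewrite E; apply: mem_prodset; last exact/fset1P.
    apply/in_row; split=> //; have := conjNV Nz.
    by rewrite E invgM invgK !mulgA mulgK.
  - apply: a_notin_N; have := coset_trans Nz (coset_sym Nz').
    by rewrite mulKg.
have sub : prodset B' C `|` Ta `|` (prodset T D `\` Pa) `<=` prodset B C.
  have sT : T `<=` B by apply/fsubsetP => z /in_row[].
  rewrite !fsubUset; apply/andP; split; first (apply/andP; split).
  - by apply: prodsetS => //; exact: fsubsetDl.
  - by apply: prodsetS => //; exact: fsubsetUr.
  - apply: fsubset_trans (fsubsetDl _ _) _.
    by apply: prodsetS => //; exact: fsubsetUl.
have := fsubset_leq_card sub.
rewrite (card_fsetU_disjoint dis2) (card_fsetU_disjoint dis1).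
have := cardfsID Pa (prodset T D).
have : #|` prodset T D `&` Pa| <= #|` Pa|.
  by apply: fsubset_leq_card; exact: fsubsetIr.
rewrite cTa cPa; lia.
Qed.

(** Rows are removed from the top by induction. The term in the size of the top row pays for the
    loss |P| in [row_step]. *)
Lemma row_bound n B t g : #|` B| <= n -> t \in B -> top t B ->
  #|` prodset B C| + 2 <= #|` B| + #|` D| + g ->
  2 * #|` B| + #|` row t B| * (#|` row t B| - 1) <= g * (g - 1).
Proof.
elim: n B t g => [|n IH] B t g.
  by rewrite leqn0 cardfs_eq0 => /eqP->.
move=> Bn Bt topt; have := row_step Bt topt.
set T := row t B; set B' := B `\` T; set P := row _ _.
have tT : t \in T by apply/in_row; rewrite Bt mulVg.
have q0 : 0 < #|` T| by rewrite cardfs_gt0; apply/fset0Pn; exists t.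
have cB : #|` B| = (#|` B'| + #|` T|)%N.
  rewrite -(cardfsID T B) addnC; congr (_ + _)%N.
  by congr #|` _|; apply/fsetIidPr/fsubsetP => z /in_row[].
have PB' : P `<=` B' by apply/fsubsetP => z /in_row[].
have B'n : #|` B'| <= n by lia.
(* If [P] is empty, any top row of the remainder will do; otherwise [P] itself is its top row. *)
have [P0|/fset0Pn[p Pp]] := eqVneq P fset0.
  rewrite P0 cardfs0 subn0 => le1 le2.
  have [B'0|B'0] := eqVneq B' fset0.
    move: le1 le2; rewrite cB B'0 prodset0l !cardfs0 !add0n => le1 le2.
    apply: triangular_lt; lia.
  have [t' B't' topt'] := exists_top B'0.
  have := card_prodset_ge HG B'0 C0.
  rewrite cC => K.
  have := IH B' t' (#|` prodset B' C| + 2 - #|` B'| - #|` D|)%N B'n B't' topt' ltac:(lia).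
  set g' := (_ - _ - _)%N => H.
  have gg : g' + #|` T| + 1 <= g by rewrite /g'; lia.
  by rewrite cB; exact: triangular_add H gg.
have [B'p Np] := in_row _ _ _ Pp.
move=> le1 le2.
have B'0 : B' != fset0 by apply/fset0Pn; exists p.
have := card_prodset_ge HG B'0 C0.
rewrite cC => K.
have rowp : row p B' = P.
  apply/fsetP => z; apply/in_row/in_row => -[B'z Nz]; split=> //.
    exact: coset_trans Nz.
  by apply: coset_trans Nz; exact: coset_sym.
(* The coset following that of [p] is tN, which has just been emptied. *)
have topp : top p B'.
  move=> x /fsetDP[Bx nT] Nx; move/negP: nT; apply; apply/in_row; split=> //.
  have := conjN Np; rewrite invgM invgK !mulgA mulVg mul1g => Np'.
  by apply: (coset_trans (y := p * a)) => //; rewrite mulgA.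
have := IH B' p (#|` prodset B' C| + 2 - #|` B'| - #|` D|)%N B'n B'p topp ltac:(lia).
rewrite rowp; set g' := (_ - _ - _)%N => H.
have p0 : 0 < #|` P| by rewrite cardfs_gt0; apply/fset0Pn; exists p.
have gg : g' + (#|` T| + 1 - #|` P|) <= g by rewrite /g'; lia.
have pB := fsubset_leq_card PB'.
by rewrite cB; exact: triangular_step H gg.
Qed.

Theorem rows_card_ge B : 7 <= #|` B| -> #|` B| + #|` C| + 2 <= #|` prodset B C|.
Proof.
move=> B7; have B0 : B != fset0 by rewrite -cardfs_gt0; lia.
have [t Bt topt] := exists_top B0.
rewrite leqNgt; apply/negP => lt.
(* With [g] = 4 the bound gives 2|B| <= 12. *)
have := row_bound (leqnn _) Bt topt (g := 4) ltac:(lia).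
lia.
Qed.

End Rows.

(** * Elements conjugating a cyclic group into itself *)

Section CyclicConjugates.
Variable G : groupType.
Hypothesis HG : unique_product_group G.
Local Open Scope group_scope.
Local Open Scope fset_scope.
Implicit Types (a b g h : G).

(** The cyclic group <b>: a difference of two natural exponents stands for an integer. *)
Definition cyclic_gen b g := exists m n, g = b ^+ m * b ^- n.

Lemma cyclic_genX b n : cyclic_gen b (b ^+ n).
Proof. by exists n, 0%N; rewrite expg0 invg1 mulg1. Qed.

Lemma cyclic_genXV b n : cyclic_gen b (b ^- n).
Proof. by exists 0%N, n; rewrite expg0 mul1g. Qed.

Lemma cyclic_gen_abs b g : cyclic_gen b g -> exists n, g = b ^+ n \/ g = b ^- n.
Proof.
move=> [m [n ->]]; have [nm|mn] := leqP n m.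
  by exists (m - n)%N; left; rewrite expgnFr.
exists (n - m)%N; right; rewrite expgnFr ?(ltnW mn) //.
by rewrite invgM invgK.
Qed.

Lemma cyclic_gen_subgroup b : subgroup (cyclic_gen b).
Proof.
split; first exact: (cyclic_genX b 0).
- move=> _ _ [m [n ->]] [p [q ->]]; exists (m + p)%N, (n + q)%N.
  rewrite !expgnDr invgM -!mulgA; congr (_ * _); rewrite !mulgA.
  have cc : commute (b ^- n) (b ^+ p).
    apply/commute_sym/commuteV/commuteX2; exact: commute_refl.
  have cc2 : commute (b ^- n) (b ^- q).
    by apply/commute_sym/commuteV/commute_sym/commuteV/commuteX2; exact: commute_refl.
  by rewrite cc -!mulgA; congr (_ * _); exact: cc2.
- by move=> _ [m [n ->]]; exists n, m; rewrite invgM invgK.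
Qed.

Lemma commute_of_power_eq g h n : 0 < n -> commute g h -> g ^+ n = h ^+ n -> g = h.
Proof.
move=> n0 gh E; apply: divg1_eq; apply: (torsion_free HG n0).
by rewrite expgnFl // E mulgV.
Qed.

(** [N] is the increasing union of the groups a^i <b> a^-i. If it contained a^k, then a^k would be a
    power of [b], so [a] would commute with some b^n, n > 0; then [b] and its conjugate by [a]
    commute and have the same n-th power, hence are equal by torsion-freeness. *)
Lemma cyclic_conj_subgroup a b : ~ commute a b -> cyclic_gen b (a^-1 * b * a) ->
  exists N : G -> Prop,
    [/\ subgroup N, forall g, N g -> N (a^-1 * g * a),
        forall g, N g -> N (a * g * a^-1),
        forall k, 0 < k -> ~ N (a ^+ k) & forall g, cyclic_gen b g -> N g].
Proof.
move=> nab ab; pose P := cyclic_gen b.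
have [P1 PM PV] : subgroup P by exact: cyclic_gen_subgroup.
have conjX g n : a^-1 * g ^+ n * a = (a^-1 * g * a) ^+ n.
  by have := conjXg g a n; rewrite !conjgE !mulgA.
have PX g n : P g -> P (g ^+ n).
  by move=> Pg; elim: n => [|n IH]; rewrite ?expgS; [exact: P1|exact: PM].
have Pconj g : P g -> P (a^-1 * g * a).
  move=> /cyclic_gen_abs[n [->|->]]; first by rewrite conjX; exact: PX.
  suff -> : a^-1 * b ^- n * a = (a^-1 * b ^+ n * a)^-1.
    by rewrite conjX; apply: PV; exact: PX.
  by rewrite !invgM !mulgA invgK.
have Pconjn i g : P g -> P (a ^- i * g * a ^+ i).
  elim: i => [|i IH] Pg; first by rewrite expg0 invg1 mul1g mulg1.
  by have := Pconj _ (IH Pg); rewrite expgSr !invgM !mulgA.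
have shift i j g : P (a ^- i * g * a ^+ i) -> P (a ^- (i + j) * g * a ^+ (i + j)).
  by move/(Pconjn j); rewrite expgnDr invgM !mulgA.
exists (fun g => exists i, P (a ^- i * g * a ^+ i)); split.
- split; first by exists 0%N; rewrite expg0 invg1 !mul1g.
  + move=> x y [i Px] [j Py]; exists (i + j)%N.
    have := PM _ _ (shift i j _ Px) (shift j i _ Py).
    by rewrite (addnC j i) !mulgA mulgK.
  + move=> x [i Px]; exists i; have := PV _ Px.
    by rewrite !invgM invgK !mulgA.
- move=> g [i Pg]; exists i; have := Pconj _ Pg.
  have E : commute (a ^- i) a^-1.
    by apply/commuteV/commute_sym/commuteV/commuteX/commute_refl.
  have E' : commute (a ^+ i) a by apply/commute_sym/commuteX/commute_refl.
  by rewrite !mulgA E -!mulgA E'.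
- move=> g [i Pg]; exists i.+1; move: Pg.
  by rewrite expgS invgM !mulgA !mulgVK.
- move=> k k0 [i]; rewrite -mulgA -expgnDr addnC expgnDr mulKg.
  move=> /cyclic_gen_abs[n E].
  have an : a ^+ k <> 1.
    by move/(torsion_free HG k0) => a1; apply: nab; rewrite a1; exact/commute_sym/commute1.
  have n0 : 0 < n.
    by case: n E => // -[]; rewrite ?expg0 ?invg1 => /an.
  have cn : commute a (b ^+ n).
    have c0 : commute a (a ^+ k) by apply/commuteX/commute_refl.
    by case: E => E; move: c0; rewrite E // => /commuteV; rewrite invgK.
  have /commute_of_power_eq : (a^-1 * b * a) ^+ n = b ^+ n.
    by rewrite -conjX -mulgA -cn mulKg.
  move=> /(_ n0) H; apply: nab.
  have bb : commute (a^-1 * b * a) b.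
    case: ab => p [q ->]; apply/commute_sym/commuteM.
      exact/commuteX/commute_refl.
    exact/commuteV/commuteX/commute_refl.
  by rewrite /commute -{1}(H bb) !mulgA mulgV mul1g.
- by move=> g Pg; exists 0%N; rewrite expg0 invg1 mul1g mulg1.
Qed.

Lemma cyclic_conj_card_ge a b (D B : {fset G}) : ~ commute a b ->
  cyclic_gen b (a^-1 * b * a) \/ cyclic_gen b (a * b * a^-1) ->
  (forall d, d \in D -> cyclic_gen b d) -> 2 <= #|` D| -> 7 <= #|` B| ->
  #|` B| + #|` D `|` [fset a]| + 2 <= #|` prodset B (D `|` [fset a])|.
Proof.
move=> nab [] ab Db D2 B7.
  have [N [sN cN cNV fN bN]] := cyclic_conj_subgroup nab ab.
  by apply: (rows_card_ge HG sN cN cNV fN) => // d /Db/bN.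
(* In the second case the subgroup built for the inverse of [a] also serves for [a]. *)
have nab' : ~ commute a^-1 b.
  by move/commute_sym/commuteV; rewrite invgK => /commute_sym/nab.
have := cyclic_conj_subgroup nab'; rewrite invgK => /(_ ab).
move=> [N [sN cN cNV fN bN]].
apply: (rows_card_ge HG sN cNV cN) => // [k k0 Nk|d /Db/bN //].
by apply: (fN k k0); rewrite expVgn; case: sN => _ _; apply.
Qed.

End CyclicConjugates.

(** * Exhaustive search over coincidence patterns *)

(* The letter (g, s) stands for x (g = false) or y (g = true), inverted when
   s = true. *)
Definition letter := (bool * bool)%type.
Definition word := seq letter.

Definition linv (l : letter) : letter := (l.1, ~~ l.2).
Definition winv (w : word) : word := rev (map linv w).

Definition cancels (l l' : letter) : bool :=
  if l.1 (+) l'.1 then false else l.2 (+) l'.2.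

Definition lcons (l : letter) (w : word) : word :=
  if w is l' :: w' then if cancels l l' then w' else l :: w else [:: l].
Definition wred (w : word) : word := foldr lcons [::] w.

(** [n] is fuel: each step removes two letters, so the length of the word suffices. *)
Fixpoint cycred n (w : word) : word :=
  if n is n'.+1 then
    if w is l :: w' then
      if rev w' is l' :: w'' then
        if cancels l l' then cycred n' (rev w'') else w
      else w
    else w
  else w.
Definition wcyc (w : word) := let v := wred w in cycred (size v) v.

Definition wsubst (s : word * word) (w : word) : word :=
  flatten [seq let v := if l.1 then s.2 else s.1 in if l.2 then winv v else v | l <- w].

(** Rotating or inverting a word does not change whether it evaluates to 1; storing all variants
    allows look-up by exact match. *)
Definition rotations (w : word) : seq word :=
  [seq rot i v | v <- [:: w; winv w], i <- iota 0 (size w)].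

Local Notation Lx := (false, false).
Local Notation LX := (false, true).
Local Notation Ly := (true, false).
Local Notation LY := (true, true).

(* The pairs (c_1 / c_0, c_2 / c_0) for the orderings (c_0, c_1, c_2) of 1, x, y. *)
Definition relabelings : seq (word * word) :=
  [:: ([:: Lx], [:: Ly]); ([:: Ly], [:: Lx]);
      ([:: LX], [:: Ly; LX]); ([:: LY], [:: Lx; LY]);
      ([:: Ly; LX], [:: LX]); ([:: Lx; LY], [:: LY])].

(* Each word, set equal to 1, makes x and y commute or makes one of them
   conjugate the other into its own cyclic group. *)
Definition templates : seq word :=
  [:: [:: Ly]; [:: Ly; Ly]; [:: Ly; Ly; Ly]; [:: Ly; Ly; Ly; Ly];
      [:: Lx; LY; LY]; [:: Lx; LY; LY; LY]; [:: Lx; LY; LY; LY; LY];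
      [:: Lx; LY; LY; Lx; LY; LY]; [:: Lx; Ly; LX; LY]; [:: LY; LX; Ly; LX];
      [:: Lx; Ly; LX; LY; LY]; [:: Lx; LY; LX; LY; LY];
      [:: LX; Ly; Lx; LY; LY]; [:: LX; LY; Lx; LY; LY]].

(** The two words of a pair, both set equal to 1, force torsion, make x and y commute, or make x
    conjugate y into <y>. *)
Definition pair_templates : seq (word * word) :=
  [:: ([:: LY; LY; LY; Lx; LY; Lx], [:: LY; LY; Lx; Lx; Lx]);
      ([:: LY; LY; LY; Lx; LY; Lx], [:: LY; LY; LX; LX]);
      ([:: LY; LY; LY; Lx; Lx], [:: LY; LY; LX; Ly; LX]);
      ([:: LY; LY; Lx; Ly; Lx], [:: LY; LX; LY; Lx; Lx])].

Inductive trie := Leaf | Node of bool & trie & trie & trie & trie.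

Fixpoint trie_mem (t : trie) (w : word) : bool :=
  if t is Node b tx tX ty tY then
    if w is l :: w' then
      trie_mem (match l with Lx => tx | LX => tX | Ly => ty | LY => tY end) w'
    else b
  else false.

Fixpoint trie_add (w : word) (t : trie) : trie :=
  let: (b, tx, tX, ty, tY) :=
    if t is Node b tx tX ty tY then (b, tx, tX, ty, tY)
    else (false, Leaf, Leaf, Leaf, Leaf) in
  if w is l :: w' then
    match l with
    | Lx => Node b (trie_add w' tx) tX ty tY
    | LX => Node b tx (trie_add w' tX) ty tY
    | Ly => Node b tx tX (trie_add w' ty) tY
    | LY => Node b tx tX ty (trie_add w' tY)
    end
  else Node true tx tX ty tY.

Definition trie_of (ws : seq word) : trie := foldr trie_add Leaf ws.

Definition relabeled (s : word * word) (t : word) : seq word :=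
  rotations (wcyc (wsubst s t)).

(** Evaluated once here, so that the search does not rebuild it; [single_trieE] recovers the
    defining expression for the soundness proof. *)
Definition single_trie : trie := Eval vm_compute in
  trie_of (flatten [seq relabeled s t | s <- relabelings, t <- templates]).

Lemma single_trieE :
  single_trie = trie_of (flatten [seq relabeled s t | s <- relabelings, t <- templates]).
Proof. reflexivity. Qed.

Definition pair_tries : seq (trie * trie) := Eval vm_compute in
  [seq (trie_of (relabeled s t.1), trie_of (relabeled s t.2))
     | s <- relabelings, t <- pair_templates].

Lemma pair_triesE :
  pair_tries = [seq (trie_of (relabeled s t.1), trie_of (relabeled s t.2))
     | s <- relabelings, t <- pair_templates].
Proof. reflexivity. Qed.

(** Conditionals replace boolean connectives, here and in the search, so that call-by-value
    evaluation skips the second test when it can. *)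
Definition killed_by_two (ws : seq word) : bool :=
  has (fun t => if has (trie_mem t.1) ws then has (trie_mem t.2) ws
                     else false) pair_tries.

(* An incidence (i, c, m) says that b_i * c is the m-th point of BC. *)
Definition incidence := (nat * nat * nat)%type.
(* An edge (j, (k, w)) says that w evaluates to b_j^-1 * b_k. *)
Definition edge := (nat * (nat * word))%type.

Definition label_word (c : nat) : word :=
  match c with 0 => [::] | 1 => [:: Lx] | _ => [:: Ly] end.

Definition edges_at c m (E : seq incidence) : seq (nat * word) :=
  [seq (e.1.1, label_word c ++ winv (label_word e.1.2)) | e <- E & eqn e.2 m].

Definition both_ways i (s : seq (nat * word)) : seq edge :=
  [seq (i, kw) | kw <- s] ++ [seq (kw.1, (i, winv kw.2)) | kw <- s].

(* The words read along the walks i -> ... -> j -> ... -> i that extend a walk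
   from i to j reading w by at most n edges. *)
Fixpoint closings n (A : seq edge) i j (w : word) : seq word :=
  if eqn j i then [:: wcyc w] else
  if n is n'.+1 then
    flatten [seq if eqn a.1 j then closings n' A i a.2.1 (w ++ a.2.2) else [::] | a <- A]
  else [::].

(* Vertex i is linked to the points of E through its labels cs; a label leads to
   one of the np known points or, as long as room allows, to a new one. *)
Section Search.
Variable next : seq incidence -> seq edge -> seq word -> nat -> nat -> bool.

Fixpoint add_incidences (cs : seq nat) i (E : seq incidence) (A : seq edge)
    (rels : seq word) np room : bool :=
  if cs is c :: cs' then
    if (if room is room'.+1 then add_incidences cs' i ((i, c, np) :: E) A rels np.+1 room'
        else true) then
      all (fun m =>
        if has (fun e => if eqn e.2 m then if eqn e.1.2 c then true else eqn e.1.1 i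
                         else false) E then true
        else let s := edges_at c m E in
             let A' := both_ways i s ++ A in
             let ws := flatten [seq closings 3 A' i kw.1 kw.2 | kw <- s] in
             if has (trie_mem single_trie) ws then true
             else add_incidences cs' i ((i, c, m) :: E) A' (ws ++ rels) np room)
        (iota 0 np)
    else false
  else next E A rels np room.
End Search.

(** A new vertex is first attached to a known point [m] by a label [f], then its other two labels
    are placed. Room left over by earlier vertices is carried along. *)
Fixpoint search (incs : seq nat) i (E : seq incidence) (A : seq edge)
    (rels : seq word) np room : bool :=
  if incs is inc :: incs' then
    all (fun m => all (fun f =>
      if has (fun e => if eqn e.2 m then eqn e.1.2 f else false) E then true
      else add_incidences (search incs' i.+1) (rem f [:: 0; 1; 2]) i ((i, f, m) :: E)
             (both_ways i (edges_at f m E) ++ A) rels np (room + inc))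
      [:: 0; 1; 2]) (iota 0 np)
  else killed_by_two rels.

(* The bounds 3, 5, 7, 8, 9 on the number of points covered by 1, ..., 5
   vertices grow by 2, 2, 1, 1. *)
Lemma search_true :
  search [:: 2; 2; 1; 1] 1 [:: (0, 0, 0); (0, 1, 1); (0, 2, 2)] [::] [::] 3 0 = true.
Proof. by vm_compute. Qed.

(** * Evaluation of words in a group *)

Section Evaluation.
Variable G : groupType.
Local Open Scope group_scope.
Implicit Types (u v g h : G) (w : word).

Definition leval u v (l : letter) : G :=
  let z := if l.1 then v else u in if l.2 then z^-1 else z.
Definition weval u v w : G := foldr (fun l g => leval u v l * g) 1 w.

Lemma weval_cat u v w1 w2 : weval u v (w1 ++ w2) = weval u v w1 * weval u v w2.
Proof. by elim: w1 => [|l w1 IH] /=; rewrite ?mul1g // IH mulgA. Qed.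

Lemma leval_linv u v l : leval u v (linv l) = (leval u v l)^-1.
Proof. by case: l => -[] []; rewrite /leval /= ?invgK. Qed.

Lemma weval_winv u v w : weval u v (winv w) = (weval u v w)^-1.
Proof.
elim: w => [|l w IH] /=; first by rewrite invg1.
by rewrite /winv map_cons rev_cons -cats1 weval_cat -/(winv w) IH /= mulg1 leval_linv invgM.
Qed.

Lemma leval_cancels u v l l' : cancels l l' -> leval u v l' = (leval u v l)^-1.
Proof. by case: l l' => -[] [] [[] []]; rewrite /cancels /leval //= invgK. Qed.

Lemma weval_wred u v w : weval u v (wred w) = weval u v w.
Proof.
elim: w => //= l w <-; case: (wred w) => //= l' w'.
by case: ifP => //= /(leval_cancels u v)->; rewrite mulVKg.
Qed.

(** The two products are conjugate. Cyclic reduction and rotation preserve only being equal to 1,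
    not the value. *)
Lemma mulg_eq1C g h : (g * h == 1) = (h * g == 1).
Proof. by rewrite mulg_eq1 -eqg_inv invgK eq_sym -mulg_eq1. Qed.

Lemma weval_cycred_eq1 u v n w : (weval u v (cycred n w) == 1) = (weval u v w == 1).
Proof.
elim: n w => //= n IH [|l w] //=.
case E : (rev w) => [|l' w'] //; case: ifP => // cl; rewrite IH.
have -> : w = rev w' ++ [:: l'] by rewrite cats1 -rev_cons -E revK.
rewrite mulg_eq1C weval_cat /= mulg1 (leval_cancels _ _ cl).
by rewrite mulgVK.
Qed.

Lemma weval_wcyc_eq1 u v w : (weval u v (wcyc w) == 1) = (weval u v w == 1).
Proof. by rewrite weval_cycred_eq1 weval_wred. Qed.

Lemma weval_rot_eq1 u v i w : (weval u v (rot i w) == 1) = (weval u v w == 1).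
Proof. by rewrite /rot weval_cat mulg_eq1C -weval_cat cat_take_drop. Qed.

Lemma weval_rotations u v w w' : w' \in rotations w ->
  (weval u v w' == 1) = (weval u v w == 1).
Proof.
move=> /allpairsP[[w'' i] [/= + _ ->]]; rewrite !inE => /orP[]/eqP->.
  exact: weval_rot_eq1.
by rewrite weval_rot_eq1 weval_winv invg_eq1.
Qed.

Lemma weval_wsubst u v s w :
  weval u v (wsubst s w) = weval (weval u v s.1) (weval u v s.2) w.
Proof.
elim: w => //= l w IH; rewrite /wsubst /= weval_cat -/(wsubst s w) IH; congr (_ * _).
by case: l => -[] []; rewrite /leval //= weval_winv.
Qed.

Lemma weval_relabeled u v s t w : w \in relabeled s t -> weval u v w = 1 ->
  weval (weval u v s.1) (weval u v s.2) t = 1.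
Proof.
move=> /(weval_rotations u v) E /eqP; rewrite E weval_wcyc_eq1 weval_wsubst.
by move/eqP.
Qed.

End Evaluation.

Lemma trie_mem_add w w' t : trie_mem (trie_add w' t) w = (w == w') || trie_mem t w.
Proof.
elim: w' w t => [|l' w' IH] w t.
  by case: t => [|b t1 t2 t3 t4]; case: w => [|[[] []] w].
case: t => [|b t1 t2 t3 t4]; case: l' => -[] []; case: w => [|[[] []] w] //=;
  by rewrite ?IH ?eqseq_cons.
Qed.

Lemma trie_mem_of ws w : trie_mem (trie_of ws) w = (w \in ws).
Proof. by elim: ws => [|w' ws IH] /=; [case: w|rewrite trie_mem_add IH in_cons]. Qed.

Lemma has_allpairs S T R (p : pred R) (f : S -> T -> R) s t :
  has p [seq f x y | x <- s, y <- t] = has (fun x => has (fun y => p (f x y)) t) s.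
Proof. by elim: s => //= x s IH; rewrite has_cat has_map IH. Qed.

Local Arguments single_trie : simpl never.
Local Arguments rem : simpl never.
Local Arguments all : simpl never.

(** * Soundness of the search *)

Section Soundness.
Variable G : groupType.
Local Open Scope group_scope.
Variables (u v : G) (b : nat -> G).
Let lim := nth 0%N [:: 0; 3; 5; 7; 8; 9]%N.
Let ev := weval u v.
Definition label (c : nat) : G := match c with 0 => 1 | 1 => u | _ => v end.
Definition point (j c : nat) : G := b j * label c.
Definition products n : seq G := [seq point j c | j <- iota 0 n, c <- iota 0 3].

Hypothesis no_single : forall s t, s \in relabelings -> t \in templates ->
  weval (ev s.1) (ev s.2) t <> 1.
Hypothesis no_pair : forall s t, s \in relabelings -> t \in pair_templates ->
  weval (ev s.1) (ev s.2) t.1 = 1 -> weval (ev s.1) (ev s.2) t.2 = 1 -> False.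
Hypothesis label_inj : {in gtn 3 &, injective label}.
Hypothesis b_inj : {in gtn 5 &, injective b}.
Hypothesis b_linked : forall i, 0 < i < 5 ->
  exists c j d, [/\ c < 3, j < i, d < 3 & point i c = point j d].
Hypothesis card_products : forall i s, 0 < i <= 5 -> uniq s ->
  {subset s <= products i} -> size s <= lim i.

Lemma lim_mono i : 0 < i < 5 -> lim i <= lim i.+1.
Proof. by case: i => [|[|[|[|[|i]]]]]. Qed.

Lemma label_wordE c : ev (label_word c) = label c.
Proof. by case: c => [|[|c]]; rewrite /ev /= ?mulg1. Qed.

Lemma productsP n z :
  reflect (exists j c, [/\ j < n, c < 3 & z = point j c]) (z \in products n).
Proof.
apply: (iffP allpairsP) => [[[j c] []]|[j [c [jn c3 ->]]]].
  by rewrite !mem_iota => /= jn c3 ->; exists j, c.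
by exists (j, c); split; rewrite // mem_iota.
Qed.

Lemma products_sub n : {subset products n <= products n.+1}.
Proof.
move=> z /productsP[j [c [jn c3 ->]]]; apply/productsP.
by exists j, c; split=> //; exact: leqW.
Qed.

Lemma single_trie_sound w : ev w = 1 -> ~~ trie_mem single_trie w.
Proof.
move=> w1; rewrite single_trieE trie_mem_of; apply/negP.
move=> /flattenP[_ /allpairsP[[s t] [/= sS tT ->]] wst].
exact: no_single sS tT (weval_relabeled wst w1).
Qed.

Lemma killed_by_two_sound ws : {in ws, forall w, ev w = 1} -> ~~ killed_by_two ws.
Proof.
move=> ws1; apply/negP; rewrite /killed_by_two pair_triesE.
rewrite has_allpairs => /hasP[s sS /hasP[t tT /=]].
case: ifP => // /hasP[w1 ww1 +] /hasP[w2 ww2 +]; rewrite !trie_mem_of => m1 m2.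
exact: (no_pair sS tT (weval_relabeled m1 (ws1 _ ww1)) (weval_relabeled m2 (ws1 _ ww2))).
Qed.

Definition edge_ok (a : edge) := ev a.2.2 = (b a.1)^-1 * b a.2.1.

(** A closed walk at [i] multiplies out to b_i^-1 b_i = 1. *)
Lemma closings_sound n A i j w w' : {in A, forall a, edge_ok a} ->
  ev w = (b i)^-1 * b j -> w' \in closings n A i j w -> ev w' = 1.
Proof.
move=> okA; elim: n j w => [|n IH] j w wij /=.
  case: ifP => //; rewrite eqnE => /eqP E; rewrite inE => /eqP->; apply/eqP.
  by rewrite /ev weval_wcyc_eq1 -/(ev w) wij E mulVg.
case: ifP => [|_].
  rewrite eqnE => /eqP E; rewrite inE => /eqP->; apply/eqP.
  by rewrite /ev weval_wcyc_eq1 -/(ev w) wij E mulVg.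
move=> /flattenP[_ /mapP[a Aa ->]]; case: ifP => //; rewrite eqnE => /eqP E.
apply: IH; rewrite /ev weval_cat -/(ev w) -/(ev a.2.2) wij okA // E.
by rewrite mulgA mulgK.
Qed.

Local Arguments closings : simpl never.

(** Ties a search state to the actual configuration: [vs] lists the distinct points met so far, in
    the order of their numbers, and [cs] the labels of vertex [i] still to be placed. *)
Record inv i (cs : seq nat) (E : seq incidence) (A : seq edge)
    (rels : seq word) (vs : seq G) : Prop := Inv {
  inv_E : {in E, forall e, [/\ e.1.1 <= i, e.1.2 < 3, e.2 < size vs
                             & point e.1.1 e.1.2 = nth 1 vs e.2]};
  inv_cs : {in E, forall e, e.1.1 = i -> e.1.2 \notin cs};
  inv_all : forall j c, j <= i -> c < 3 -> (j < i) || (c \notin cs) ->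
    exists m, (j, c, m) \in E;
  inv_A : {in A, forall a, edge_ok a};
  inv_rels : {in rels, forall w, ev w = 1};
  inv_uniq : uniq vs;
  inv_sub : {subset vs <= products i.+1} }.

(** The coincidence b_i c = b_j d means b_i^-1 b_j = c d^-1. *)
Lemma edges_at_ok i c m E vs kw :
  {in E, forall e, point e.1.1 e.1.2 = nth 1 vs e.2} ->
  point i c = nth 1 vs m -> kw \in edges_at c m E ->
  ev kw.2 = (b i)^-1 * b kw.1.
Proof.
move=> okE im /mapP[e]; rewrite mem_filter eqnE => /andP[/eqP em Ee] -> /=.
rewrite /ev weval_cat weval_winv -/(ev _) -/(ev (label_word _)) !label_wordE.
have := okE _ Ee; rewrite em -im => H.
by apply: (mulgI (b i)); rewrite mulVKg mulgA -/(point i c) -H mulgK.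
Qed.

Lemma both_ways_ok i s : {in s, forall kw, ev kw.2 = (b i)^-1 * b kw.1} ->
  {in both_ways i s, forall a, edge_ok a}.
Proof.
move=> ok a; rewrite mem_cat => /orP[]/mapP[kw skw ->]; rewrite /edge_ok /= -?ok //.
by rewrite /ev weval_winv -/(ev _) ok // invgM invgK.
Qed.

(** Follow the branch dictated by [point i c]: if the point is new, [card_products] guarantees room
    for it; if it is known, none of the pruning tests can succeed. *)
Lemma add_incidences_sound next i cs E A rels vs room : i < 5 ->
  uniq cs -> {in cs, forall c, c < 3} ->
  inv i cs E A rels vs -> size vs + room = lim i.+1 ->
  add_incidences next cs i E A rels (size vs) room ->
  exists E' A' rels' vs' room', [/\ inv i [::] E' A' rels' vs',
    size vs' + room' = lim i.+1 & next E' A' rels' (size vs') room'].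
Proof.
move=> i5; elim: cs E A rels vs room => [|c cs IH] E A rels vs room /=.
  by move=> _ _ I lm nx; exists E, A, rels, vs, room.
move=> /andP[c_cs ucs] cs3 I lm.
have c3 : c < 3 by apply: cs3; rewrite inE eqxx.
have cs3' : {in cs, forall c, c < 3} by move=> d dcs; apply: cs3; rewrite inE dcs orbT.
have [oE oc oall oA oR uvs sub] := I.
case: ifP => // newP /allP oldP.
have [bc_vs|bc_vs] := boolP (point i c \in vs); last first.
  have uvs' : uniq (rcons vs (point i c)) by rewrite rcons_uniq bc_vs.
  have sub' : {subset rcons vs (point i c) <= products i.+1}.
    move=> z; rewrite mem_rcons inE => /orP[/eqP->|/sub //].
    by apply/productsP; exists i, c.
  have := card_products (i := i.+1) i5 uvs' sub'.
  move=> lt; rewrite size_rcons -lm in lt.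
  case: room lm lt newP {oldP} => [|room] lm lt newP; first by move: lt; rewrite addn0 ltnn.
  apply: (IH ((i, c, size vs) :: E) A rels (rcons vs (point i c)) room) => //.
  - split=> //.
    + move=> e; rewrite inE => /orP[/eqP->|/oE[? ? lt' H]] /=.
        by rewrite size_rcons nth_rcons ltnn eqxx.
      by rewrite size_rcons nth_rcons lt'; split=> //; exact: leqW.
    + move=> e; rewrite inE => /orP[/eqP-> //|Ee ei].
      by have := oc e Ee ei; rewrite inE negb_or => /andP[].
    + move=> j d ji d3 jd.
      have [/eqP[-> ->]|ne] := boolP ((j, d) == (i, c)).
        by exists (size vs); rewrite inE eqxx.
      have [|m Em] := oall j d ji d3; last by exists m; rewrite inE Em orbT.
      case/orP: jd => [->//|dcs]; rewrite inE negb_or dcs andbT.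
      case: (ltngtP j i) ji => // ji _; move: ne; rewrite ji xpair_eqE eqxx /=.
      by move=> ->.
  - by rewrite size_rcons; lia.
  - by rewrite size_rcons.
have [m mlt mE] : exists2 m, m < size vs & nth 1 vs m = point i c.
  by exists (index (point i c) vs); rewrite ?index_mem ?nth_index.
have := oldP m; rewrite mem_iota /= add0n => /(_ mlt).
(* If the m-th point was already reached by the same label or from the same vertex, injectivity
   identifies that incidence with the one being placed, although [c] is still pending. *)
case: ifP => [/hasP[e Ee]|_].
  case: ifP => //; rewrite !eqnE => /eqP em.
  have [ei e3 _ eE] := oE _ Ee; rewrite em mE in eE.
  case: ifP => [/eqP ec _|_ /eqP ei'].
    have ei' : e.1.1 = i.
      apply: b_inj; rewrite ?inE //; first by exact: leq_ltn_trans ei i5.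
      by move: eE; rewrite /point ec => /mulIg.
    by have := oc _ Ee ei'; rewrite ec inE eqxx.
  have ec : e.1.2 = c.
    by apply: label_inj; rewrite ?inE //; move: eE; rewrite /point ei' => /mulgI.
  by have := oc _ Ee ei'; rewrite ec inE eqxx.
set s := edges_at c m E.
have okE : {in E, forall e, point e.1.1 e.1.2 = nth 1 vs e.2}.
  by move=> e /oE[].
have oks : {in s, forall kw, ev kw.2 = (b i)^-1 * b kw.1}.
  by move=> kw; exact: edges_at_ok okE (esym mE).
have okA' : {in both_ways i s ++ A, forall a, edge_ok a}.
  by move=> a; rewrite mem_cat => /orP[/(both_ways_ok oks)|/oA].
set ws := flatten _.
have okws : {in ws, forall w, ev w = 1}.
  move=> w /flattenP[_ /mapP[kw skw ->]].
  exact: (closings_sound (n := 3) okA' (oks _ skw)).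
case: ifP => [/hasP[w wws kw]|_].
  by case/negP: (single_trie_sound (okws _ wws)).
apply: IH => //; split=> //.
- by move=> e; rewrite inE => /orP[/eqP->|/oE //].
- move=> e; rewrite inE => /orP[/eqP-> //|Ee ei].
  by have := oc e Ee ei; rewrite inE negb_or => /andP[].
- move=> j d ji d3 jd.
  have [/eqP[-> ->]|ne] := boolP ((j, d) == (i, c)).
    by exists m; rewrite inE eqxx.
  have [|m' Em] := oall j d ji d3; last by exists m'; rewrite inE Em orbT.
  case/orP: jd => [->//|dcs]; rewrite inE negb_or dcs andbT.
  case: (ltngtP j i) ji => // ji _; move: ne; rewrite ji xpair_eqE eqxx /=.
  by move=> ->.
- by move=> w; rewrite mem_cat => /orP[/okws|/oR].
Qed.

(** [n] vertices remain to be added, and [b_linked] selects the attaching point and label. At the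
    end all collected relations hold, so no pair of templates can occur among them. *)
Lemma search_step_sound n i E A rels vs room : i + n = 4 ->
  inv i [::] E A rels vs -> size vs + room = lim i.+1 ->
  search [seq lim k.+1 - lim k | k <- iota i.+1 n] i.+1 E A rels (size vs) room ->
  False.
Proof.
elim: n i E A rels vs room => [|n IH] i E A rels vs room i4 [oE oc oall oA oR uvs sub] lm /=.
  by apply/negP/killed_by_two_sound.
move=> /allP H.
have [f [j [d [f3 ji d3 bE]]]] := b_linked (i := i.+1) ltac:(lia).
have [m Em] := oall j d ji d3 (orbT _).
have [_ _ mlt mE] := oE _ Em; rewrite /= in mlt mE.
have := H m; rewrite mem_iota => /(_ mlt)/allP/(_ f).
have -> : f \in [:: 0; 1; 2]%N by case: f f3 {bE} => [|[|[|]]].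
move=> /(_ isT).
case: ifP => [/hasP[e Ee]|_].
  case: ifP => //; rewrite !eqnE => /eqP em /eqP ef.
  have [ei _ _ eE] := oE _ Ee; rewrite em -mE -bE ef in eE.
  have := b_inj _ _ (mulIg _ _ _ eE); rewrite !inE => /(_ ltac:(lia) ltac:(lia)); lia.
have bm : point i.+1 f = nth 1 vs m by rewrite bE.
have okE : {in E, forall e, point e.1.1 e.1.2 = nth 1 vs e.2} by move=> e /oE[].
have oks : {in edges_at f m E, forall kw, ev kw.2 = (b i.+1)^-1 * b kw.1}.
  by move=> kw; exact: edges_at_ok okE bm.
move=> /(@add_incidences_sound _ i.+1 _ _ _ _ vs) [].
- lia.
- exact: rem_uniq.
- by move=> c /mem_rem; rewrite !inE => /or3P[]/eqP->.
- split=> //.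
  + move=> e; rewrite inE => /orP[/eqP->|/oE[ei ? ? ?]] //=.
    by split=> //; exact: leqW.
  + move=> e; rewrite inE => /orP[/eqP-> _|/oE[ei _ _ _] ei'] /=.
      by rewrite mem_rem_uniq // !inE eqxx.
    by move: ei; rewrite ei' ltnn.
  + move=> k c ki c3; rewrite mem_rem_uniq // !inE /=.
    case: (ltngtP k i.+1) ki => // ki _ /=.
      by move=> _; have [m' Em'] := oall k c ki c3 (orbT _); exists m'; rewrite inE Em' orbT.
    rewrite negb_and negbK ki => /orP[/eqP->|].
      by exists m; rewrite inE eqxx.
    by case: c c3 => [|[|[|]]].
  + by move=> a; rewrite mem_cat => /orP[/(both_ways_ok oks)|/oA].
  + by move=> z /sub/products_sub.
- by have := lim_mono (i := i.+1) ltac:(lia); lia.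
move=> E' [A' [rels' [vs' [room' [I' lm' S']]]]].
by apply: (IH i.+1 _ _ _ _ _ _ I' lm' S'); lia.
Qed.

Lemma no_small_configuration : False.
Proof.
have uvs : uniq [seq point 0 c | c <- iota 0 3].
  rewrite map_inj_in_uniq ?iota_uniq // => c d; rewrite !mem_iota => c3 d3 /mulgI.
  exact: label_inj.
apply: (@search_step_sound 4 0 _ _ _ [:: point 0 0; point 0 1; point 0 2]%N 0
  (erefl _) _ (erefl _) search_true).
split=> //.
- by move=> e; rewrite !inE => /or3P[]/eqP->.
- by case=> [|//] [|[|[|]]] // _ _ _; [exists 0%N|exists 1%N|exists 2%N].
Qed.

End Soundness.

(** * Sets of three elements *)

Section ThreeSets.
Variable G : groupType.
Hypothesis HG : unique_product_group G.
Local Open Scope group_scope.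
Local Open Scope fset_scope.
Implicit Types (u v : G) (B X S T : {fset G}).

(** A counterexample with C = {1, u, v}, where |B| + 5 is |B| + |C| + 2. *)
Definition exceptional u v := ~ commute u v /\
  exists2 B, 7 <= #|` B| & #|` prodset B [fset 1; u; v]| < #|` B| + 5.

Lemma exceptional_sym u v : exceptional u v -> exceptional v u.
Proof.
move=> [nc [B B7 lt]]; split; first by move/commute_sym.
exists B => //; suff -> : [fset 1; v; u] = [fset 1; u; v] by [].
by apply/fsetP => z; rewrite !inE; case: (z == 1); case: (z == u); case: (z == v).
Qed.

(** Right translation of {1, u, v} by the inverse of [u] preserves the size of the product set. With
    [exceptional_sym] this generates all six relabelings. *)
Lemma exceptional_div u v : exceptional u v -> exceptional u^-1 (v * u^-1).
Proof.
move=> [nc [B B7 lt]]; split.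
  move=> H; apply/nc/commute_sym; rewrite -[u]invgK; apply: commuteV.
  by apply: (mulIg u^-1); rewrite -[LHS]H mulgA.
exists B => //.
suff -> : [fset 1; u^-1; v * u^-1] = prodset [fset 1; u; v] [fset u^-1].
  by rewrite -prodsetA card_prodset1r.
apply/fsetP => z; apply/idP/prodsetP.
  rewrite !inE => /orP[/orP[]|] /eqP->.
  - by exists u, u^-1; split; rewrite ?inE ?eqxx ?orbT ?mulgV.
  - by exists 1, u^-1; split; rewrite ?inE ?eqxx ?mul1g.
  - by exists v, u^-1; split; rewrite ?inE ?eqxx ?orbT.
move=> [c [_ [+ /fset1P-> ->]]]; rewrite !inE => /orP[/orP[]|] /eqP->.
- by rewrite mul1g eqxx orbT.
- by rewrite mulgV eqxx.
- by rewrite eqxx orbT.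
Qed.

Lemma exceptional_relabel u v s : exceptional u v -> s \in relabelings ->
  exceptional (weval u v s.1) (weval u v s.2).
Proof.
move=> ex; have ex' := exceptional_sym ex.
rewrite !inE => /orP[|/orP[|/orP[|/orP[|/orP[|]]]]] /eqP->;
  rewrite /weval /leval /= ?mulg1 //; try exact: exceptional_div;
  exact/exceptional_sym/exceptional_div.
Qed.

Lemma exceptional_neq u v : exceptional u v -> [/\ u != 1, v != 1 & u != v].
Proof.
move=> [nc _]; split; apply/eqP => E; apply: nc; rewrite E.
- exact/commute_sym/commute1.
- exact: commute1.
- exact: commute_refl.
Qed.

Lemma exceptional_card u v : exceptional u v -> #|` [fset 1; u; v]| = 3.
Proof.
move=> /exceptional_neq[u1 v1 uv].
by rewrite -!fsetUA !cardfsU1 cardfs1 !inE negb_or !(eq_sym 1) u1 v1 uv.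
Qed.

(** Otherwise the coset count, with {1, v} as the part in <v>, would give |BC| >= |B| + 5. *)
Lemma exceptional_conj u v : exceptional u v ->
  ~ cyclic_gen v (u^-1 * v * u) /\ ~ cyclic_gen v (u * v * u^-1).
Proof.
move=> ex; have [nc [B B7 lt]] := ex; have [_ v1 _] := exceptional_neq ex.
have c3 := exceptional_card ex.
have E : [fset 1; v] `|` [fset u] = [fset 1; u; v].
  by apply/fsetP => z; rewrite !inE; case: (z == 1); case: (z == u); case: (z == v).
have Dv d : d \in [fset 1; v] -> cyclic_gen v d.
  by rewrite !inE => /orP[]/eqP->; [exact: (cyclic_genX v 0)|exact: (cyclic_genX v 1%N)].
have D2 : 2 <= #|` [fset 1; v]| by rewrite cardfs2 eq_sym v1.
suff H : ~ (cyclic_gen v (u^-1 * v * u) \/ cyclic_gen v (u * v * u^-1)).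
  by split=> h; apply: H; [left|right].
move=> H; have := cyclic_conj_card_ge HG nc H Dv D2 B7.
by rewrite E c3; lia.
Qed.

Lemma commute_powers u v n : u = v ^+ n -> commute u v.
Proof. by move->; apply/commute_sym/commuteX/commute_refl. Qed.

Lemma exceptional_template u v t : exceptional u v -> t \in templates ->
  weval u v t <> 1.
Proof.
move=> ex; have [nc _] := ex; have [u1 v1 _] := exceptional_neq ex.
have [n1 n2] := exceptional_conj ex.
have [n1' _] := exceptional_conj (exceptional_sym ex).
have tf n : v ^+ n.+1 <> 1.
  by move/(torsion_free HG (ltn0Sn n)) => E; rewrite E eqxx in v1.
have pw n : u * v ^- n <> 1 by move/divg1_eq/commute_powers.
have vv : cyclic_gen v (v * v) by exact: (cyclic_genX v 2).
have vV : cyclic_gen v (v * v)^-1 by exact: (cyclic_genXV v 2).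
rewrite /templates !inE.
(* Four words make [v] torsion; the next four make [u] a power of [v], the last of them after
   extracting a square root of 1; then come the commutator, [v] inverting [u], and [u] conjugating
   [v] to its square or inverse square. *)
move=> /orP[|/orP[|/orP[|/orP[|/orP[|/orP[|/orP[|/orP[|/orP[|/orP[|/orP[|/orP[|/orP[|]]]]]]]]]]]]] /eqP->;
  rewrite /weval /leval /= ?mulg1.
- exact: (tf 0).
- exact: (tf 1%N).
- exact: (tf 2).
- exact: (tf 3).
- by rewrite -invgM; exact: (pw 2).
- by rewrite -!invgM -mulgA; exact: (pw 3).
- by rewrite -!invgM -!mulgA; exact: (pw 4).
- move=> E; apply: (pw 2); apply: (torsion_free HG (isT : 0 < 2)).
  by rewrite expg2 -E expg2 invgM !mulgA.
- rewrite !mulgA => /divg1_eq E; apply: nc.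
  by rewrite /commute -[in RHS]E mulgVK.
- move=> E; apply: n1'; suff -> : v^-1 * u * v = u^-1 by exact: (cyclic_genXV u 1%N).
  apply: invg_inj; rewrite invgK !invgM invgK; apply: divg1_eq.
  by rewrite -E !mulgA.
- move=> E; apply: n2; suff -> : u * v * u^-1 = v * v by [].
  by apply: divg1_eq; rewrite -E invgM !mulgA.
- move=> E; apply: n2; suff -> : u * v * u^-1 = (v * v)^-1 by [].
  apply: invg_inj; rewrite invgK; apply: divg1_eq.
  by rewrite -E !invgM invgK !mulgA.
- move=> E; apply: n1; suff -> : u^-1 * v * u = v * v by [].
  by apply: divg1_eq; rewrite -E invgM !mulgA.
- move=> E; apply: n1; suff -> : u^-1 * v * u = (v * v)^-1 by [].
  apply: invg_inj; rewrite invgK; apply: divg1_eq.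
  by rewrite -E !invgM invgK !mulgA.
Qed.

(* With w = v^-1 * u the first relation says v^2 = w^2, so z = v^2 is central
   and v^-1 * u * v = u^-1 * z^2; a relation between powers of u and z is then
   inverted by conjugation. *)
Lemma conj_power_central u v n : v * v = v^-1 * u * (v^-1 * u) ->
  v^-1 * u ^+ n * v = u ^- n * (v * v) ^+ (2 * n).
Proof.
move=> E; pose w := v^-1 * u; have uE : u = v * w by rewrite mulVKg.
have cv : commute v (v * v) by rewrite /commute !mulgA.
have cw : commute w (v * v) by rewrite E /commute !mulgA.
have cz : commute u (v * v).
  by rewrite uE; apply/commute_sym/commuteM; exact: commute_sym.
have cj : v^-1 * u * v = u^-1 * (v * v) ^+ 2.
  apply: (mulgI u); rewrite mulVKg -/w.
  have -> : u * (w * v) = v * (w * w) * v by rewrite uE !mulgA.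
  by rewrite -E expg2 !mulgA.
have := conjXg u v n; rewrite !conjgE !mulgA => ->.
rewrite cj expgMn ?expVgn ?expgnA //.
by apply/commuteX/commute_sym/commuteV/commute_sym.
Qed.

Lemma exceptional_pair u v t : exceptional u v -> t \in pair_templates ->
  weval u v t.1 = 1 -> weval u v t.2 = 1 -> False.
Proof.
move=> ex; have [nc _] := ex; have [u1 v1 _] := exceptional_neq ex.
have [n1 _] := exceptional_conj ex.
have tf n : v ^+ n.+1 <> 1.
  by move/(torsion_free HG (ltn0Sn n)) => E; rewrite E eqxx in v1.
rewrite /pair_templates !inE => /orP[|/orP[|/orP[|]]] /eqP->;
  rewrite /weval /leval /= ?mulg1 => E1 E2.
(* With z = v^2, here u^3 = z; the conjugation formula gives z^2 = z^6, so v^8 = 1. *)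
- have E : v * v = v^-1 * u * (v^-1 * u).
    by apply: (mulgI (v * v)^-1); rewrite mulVg -E1 invgM !mulgA.
  have u3 : u ^+ 3 = v * v.
    by apply: (mulgI (v * v)^-1); rewrite mulVg -E2 invgM !expgS expg0 mulg1 !mulgA.
  have := conj_power_central 3 E; rewrite u3 mulKg => H.
  have H' : v * v * (v * v) = (v * v) ^+ 6 by rewrite {2}H mulVKg.
  apply: (tf 7); rewrite -[8]/(2 * 4)%N expgnA expg2.
  by apply: (mulgI ((v * v) ^+ 2)); rewrite -expgnDr mulg1 expg2 H'.
(* Here u^2 = z^-1, and the same formula gives z^6 = 1, that is v^12 = 1. *)
- have E : v * v = v^-1 * u * (v^-1 * u).
    by apply: (mulgI (v * v)^-1); rewrite mulVg -E1 invgM !mulgA.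
  have /mulg1_eq : (v * v)^-1 * (u * u)^-1 = 1 by rewrite -E2 !invgM !mulgA.
  rewrite invgK => e.
  have := conj_power_central 2 E; rewrite expg2 -[u * u]invgK -e invgK => H.
  have z6 : (v * v) ^+ 6 = 1.
    rewrite -[6]/(1 + (1 + 4))%N !expgnDr expg1 -H.
    by rewrite !invgM !mulgA mulgK mulgV mul1g mulVg.
  by apply: (tf 11); rewrite -[12]/(2 * 6)%N expgnA.
- apply: n1; have u2 : u * u = v ^+ 3.
    by apply: (mulgI (v ^- 3)); rewrite mulVg -E1 !expgS expg0 mulg1 !invgM !mulgA.
  have H : u^-1 * v * u^-1 = v ^+ 2.
    by apply: (mulgI (v * v)^-1); rewrite expg2 mulVg -E2 invgM !mulgA.
  suff -> : u^-1 * v * u = v ^+ 5 by exact: cyclic_genX.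
  by rewrite -[5]/(2 + 3)%N expgnDr -u2 -H !mulgA mulgVK.
(* The elements [i] and [j] satisfy the quaternion relations i^2 = j^2 and iji = j, which force i^4
   = 1. *)
- pose i := u * v; pose j := v * u.
  have A : u * v * u = v * v.
    by apply: (mulgI (v * v)^-1); rewrite mulVg -E1 invgM !mulgA.
  have B : v * u * v = u * u.
    by apply/esym; apply: (mulgI (v * u * v)^-1); rewrite mulVg -E2 !invgM !mulgA.
  have j2 : j * j = u ^+ 3 by rewrite /j mulgA B !expgS expg0 mulg1 !mulgA.
  have i2 : i * i = j * j.
    by rewrite j2 !expgS expg0 mulg1 -[u * u]B /i !mulgA.
  have ji : j * i = u^-1 * j * u.
    apply: (mulgI u); rewrite /i /j !mulgA mulgV mul1g.
    by rewrite A -(mulgA v v u) -(mulgA v (v * u) v) B mulgA.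
  have ji2 : j * i * (j * i) = j * j.
    have -> : j * i * (j * i) = u^-1 * (j * j) * u by rewrite ji !mulgA mulgK.
    by rewrite j2 -mulgA -expgSr expgS mulKg.
  have iji : i * j * i = j.
    by apply: (mulgI j); rewrite -ji2 !mulgA.
  have zz : i * i = i * i * (i * i * (i * i)).
    rewrite {1}i2 -{1 2}iji.
    have -> : i * j * i * (i * j * i) = i * (j * (i * i) * j) * i by rewrite !mulgA.
    have -> : j * (i * i) * j = i * i * (i * i) by rewrite i2 !mulgA.
    by rewrite !mulgA.
  have i4 : i ^+ 4 = 1.
    by apply: (mulgI (i * i)); rewrite mulg1 [RHS]zz !expgS expg0 mulg1 !mulgA.
  apply: nc; have := torsion_free HG (isT : 0 < 4) i4 => /mulg1_eq <-.
  exact/commuteV/commute_refl.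
Qed.

(** If g c1 = h d1 and g c2 = h d2, then c1 d1^-1 d2 c2^-1 = 1. Outside the degenerate cases this is
    always a relabeled template, so distinct translates of [C] share at most one point. *)
Lemma double_link_words (L := [:: 0; 1; 2]%N) :
  all (fun c1 => all (fun d1 => all (fun c2 => all (fun d2 =>
    [|| c1 == c2, c1 == d1, c2 == d2, d1 == d2 | trie_mem single_trie
       (wcyc (label_word c1 ++ winv (label_word d1)
              ++ label_word d2 ++ winv (label_word c2)))]) L) L) L) L.
Proof. by vm_compute. Qed.

(** * Overlaps between translates of an exceptional triple *)

Section Exceptional.
Variables (u v : G).
Hypothesis ex : exceptional u v.
Let C := [fset 1; u; v].
Let cC : #|` C| = 3 := exceptional_card ex.

Lemma mem_tripleP z : reflect (exists2 c, c < 3 & z = label u v c) (z \in C).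
Proof.
rewrite !inE -orbA; apply: (iffP or3P).
  by case=> /eqP->; [exists 0%N|exists 1%N|exists 2%N].
by case=> -[|[|[|//]]] _ ->; [apply: Or31|apply: Or32|apply: Or33].
Qed.

Lemma exceptional_label_inj : {in gtn 3 &, injective (label u v)}.
Proof.
have [u1 v1 uv] := exceptional_neq ex.
move=> [|[|[|//]]] [|[|[|//]]] _ _ //= /eqP;
  by rewrite ?(negPf u1) ?(negPf v1) ?(negPf uv) // eq_sym
     ?(negPf u1) ?(negPf v1) ?(negPf uv).
Qed.

Let C0 : C != fset0. Proof. by rewrite -cardfs_gt0 cC. Qed.

Let no_single s t : s \in relabelings -> t \in templates ->
  weval (weval u v s.1) (weval u v s.2) t <> 1.
Proof. by move=> sR; exact: exceptional_template (exceptional_relabel ex sR). Qed.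

Lemma card_pair g h : g != h -> 5 <= #|` prodset [fset g; h] C|.
Proof.
move=> gh; rewrite prodsetUl; have := cardfsUI (prodset [fset g] C) (prodset [fset h] C).
rewrite !card_prodset1l cC; set I := _ `&` _ => UI; rewrite leqNgt; apply/negP => lt.
have I2 : 2 <= #|` I| by lia.
have /fset0Pn[z1 I1] : I != fset0 by rewrite -cardfs_gt0; lia.
have /fset0Pn[z2] : I `\ z1 != fset0.
  by rewrite -cardfs_gt0; have := cardfsD1 z1 I; rewrite I1; lia.
rewrite in_fsetD1 => /andP[z21 {}I2].
have inI z : z \in I -> exists c d, [/\ c < 3, d < 3, z = g * label u v c & z = h * label u v d].
  move=> /fsetIP[/prodsetP[_ [_ [/fset1P-> /mem_tripleP[c c3 ->] E]]]].
  by move=> /prodsetP[_ [_ [/fset1P-> /mem_tripleP[d d3 ->] E']]]; exists c, d.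
have [c1 [d1 [c13 d13 E1 E1']]] := inI _ I1.
have [c2 [d2 [c23 d23 E2 E2']]] := inI _ I2.
have mL c : c < 3 -> c \in [:: 0; 1; 2]%N by case: c => [|[|[|]]].
have := allP (allP (allP (allP double_link_words _ (mL _ c13)) _ (mL _ d13)) _ (mL _ c23))
  _ (mL _ d23).
case/or4P => [/eqP e|/eqP e|/eqP e|/orP[/eqP e|]].
- by rewrite E1 E2 e eqxx in z21.
- by move: E1'; rewrite E1 e => /mulIg e'; rewrite e' eqxx in gh.
- by move: E2'; rewrite E2 e => /mulIg e'; rewrite e' eqxx in gh.
- by rewrite E1' E2' e eqxx in z21.
apply/negP/(single_trie_sound no_single)/eqP; rewrite weval_wcyc_eq1 !weval_cat !weval_winv.
rewrite !label_wordE; apply/eqP.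
have -> : label u v c1 = g^-1 * (h * label u v d1) by rewrite -E1' E1 mulKg.
have -> : label u v c2 = g^-1 * (h * label u v d2) by rewrite -E2' E2 mulKg.
by rewrite !invgM invgK !mulgA !mulgK mulVg.
Qed.

Lemma card_ge2 T : 2 <= #|` T| -> #|` T| + 3 <= #|` prodset T C|.
Proof.
move=> T2; have [X sX [cX le]] := shrink_left HG C0 T2.
have /fset0Pn[g Xg] : X != fset0 by rewrite -cardfs_gt0 cX.
have := cardfsD1 g X; rewrite Xg cX => /(congr1 predn)/= /esym/eqP/cardfs1P[h E].
have : h \in X `\ g by rewrite E fset11.
rewrite in_fsetD1 => /andP[hg Xh].
have XE : X = [fset g; h] by rewrite -(fsetD1K Xg) E.
have ar p t q : p + t <= q + 2 -> 5 <= p -> t + 3 <= q by lia.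
by apply: (ar _ _ _ le); rewrite XE; apply: card_pair; rewrite eq_sym.
Qed.

(** Were the products of the two parts disjoint, each part would contribute at least 2 beyond its
    size, and one with two or more elements at least 3, so |XC| >= |X| + 5. *)
Lemma linked X S : 3 <= #|` X| -> #|` prodset X C| <= #|` X| + 4 ->
  S `<=` X -> S != fset0 -> X `\` S != fset0 ->
  exists t s c d, [/\ t \in X `\` S, s \in S, c < 3, d < 3
                   & t * label u v c = s * label u v d].
Proof.
move=> X3 le sS S0 T0; apply: contrapT => H.
have XE : X = S `|` (X `\` S) by rewrite -{1}(fsetID S X) (fsetIidPr sS).
have cX : #|` X| = (#|` S| + #|` X `\` S|)%N.
  by have := cardfsID S X; rewrite (fsetIidPr sS).
have : #|` prodset X C| = (#|` prodset S C| + #|` prodset (X `\` S) C|)%N.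
  rewrite {1}XE prodsetUl card_fsetU_disjoint // => z.
  move=> /prodsetP[s [_ [Ss /mem_tripleP[d d3 ->] ->]]]; apply/negP.
  by move=> /prodsetP[t [_ [Tt /mem_tripleP[c c3 ->] E]]]; apply: H; exists t, s, c, d.
have := card_prodset_ge HG S0 C0; have := card_prodset_ge HG T0 C0; rewrite cC.
have [S2|S2] := leqP 2 #|` S|; first by have := card_ge2 S2; lia.
by have := card_ge2 (T := X `\` S) ltac:(lia); lia.
Qed.

End Exceptional.

(** Nested subsets of sizes 5, 4, 3 satisfy |XC| <= |X| + 4, which gives the bounds 9, 8, 7.
    [linked] orders their elements so that each translate meets an earlier one. *)
Theorem not_exceptional u v : ~ exceptional u v.
Proof.
move=> ex; have [_ [B B7 lt]] := ex.
have cC := exceptional_card ex; set C := [fset 1; u; v] in cC lt.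
have C0 : C != fset0 by rewrite -cardfs_gt0 cC.
have [X5 _ [c5 le5]] := shrink_left HG (A := B) (k := 5) C0 ltac:(lia).
have [X4 s4 [c4 le4]] := shrink_left HG (A := X5) (k := 4) C0 ltac:(lia).
have [X3 s3 [c3 le3]] := shrink_left HG (A := X4) (k := 3) C0 ltac:(lia).
have h5 : #|` prodset X5 C| <= #|` X5| + 4 by lia.
have h4 : #|` prodset X4 C| <= #|` X4| + 4 by lia.
have h3 : #|` prodset X3 C| <= #|` X3| + 4 by lia.
have ne (A A' : {fset G}) : #|` A'| < #|` A| -> A' `<=` A -> A `\` A' != fset0.
  by move=> ltA sA; rewrite -cardfs_gt0 cardfsDS // subn_gt0.
have [b0 Xb0] : exists b0, b0 \in X3 by apply/fset0Pn; rewrite -cardfs_gt0 c3.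
have [] := linked (X := X3) (S := [fset b0]) ex (eq_leq (esym c3)) h3.
- by rewrite fsub1set.
- by rewrite -cardfs_gt0 cardfs1.
- by apply: ne; rewrite ?cardfs1 ?c3 // fsub1set.
move=> b1 [_ [k1 [l1 [/fsetDP[X3b1 nb1] /fset1P-> k13 l13 E1]]]].
rewrite in_fset1 in nb1.
have s01 : [fset b0; b1] `<=` X3 by rewrite fsubUset !fsub1set Xb0.
have [] := linked (X := X3) (S := [fset b0; b1]) ex (eq_leq (esym c3)) h3 s01.
- by rewrite -cardfs_gt0 cardfs2.
- by apply: ne; rewrite ?cardfs2 ?c3 // ltnS; case: (_ != _).
move=> b2 [a2 [k2 [l2 [/fsetDP[X3b2 nb2] A2 k23 l23 E2]]]].
have [] := linked (X := X4) (S := X3) ex ltac:(rewrite c4; exact: isT) h4 s3.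
- by rewrite -cardfs_gt0 c3.
- by apply: ne; rewrite ?c3 ?c4.
move=> b3 [a3 [k3 [l3 [/fsetDP[X4b3 nb3] A3 k33 l33 E3]]]].
have [] := linked (X := X5) (S := X4) ex ltac:(rewrite c5; exact: isT) h5 s4.
- by rewrite -cardfs_gt0 c4.
- by apply: ne; rewrite ?c4 ?c5.
move=> b4 [a4 [k4 [l4 [/fsetDP[X5b4 nb4] A4 k43 l43 E4]]]].
have X3b b : b \in [:: b0; b1; b2] -> b \in X3.
  by rewrite !inE => /or3P[]/eqP->.
have u3 : uniq [:: b0; b1; b2].
  by move: nb2; rewrite /= !inE !negb_or !(eq_sym _ b2) (eq_sym b0) nb1 => /andP[-> ->].
have X3E z : z \in X3 -> z \in [:: b0; b1; b2].
  have sub : [fset b0; b1; b2] `<=` X3.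
    by apply/fsubsetP => b; rewrite !inE -orbA => H; apply: X3b; rewrite !inE.
  have : [fset b0; b1; b2] == X3.
    rewrite eqEfcard sub c3; apply: (uniq_leq_size u3) => b.
    by rewrite !inE -orbA.
  by move/eqP => <-; rewrite !inE -orbA.
have X4E z : z \in X4 -> z \in [:: b0; b1; b2; b3].
  have : b3 |` X3 == X4.
    rewrite eqEfcard fsubUset fsub1set X4b3 s3 c4 cardfsU1 c3 nb3; exact: isT.
  move/eqP => <-; rewrite in_fset1U => /orP[/eqP->|/X3E]; first by rewrite !inE eqxx !orbT.
  by rewrite !inE => /or3P[]->; rewrite ?orbT.
pose bs := [:: b0; b1; b2; b3; b4].
have ubs : uniq bs.
  have n3 : b3 \notin [:: b0; b1; b2] by apply: contra nb3; exact: X3b.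
  have n4 : b4 \notin [:: b0; b1; b2; b3].
    apply: contra nb4; rewrite (mem_rcons [:: b0; b1; b2] b3) in_cons.
    by move=> /orP[/eqP->//|/X3b/(fsubsetP s3)].
  by rewrite -[bs]/(rcons (rcons [:: b0; b1; b2] b3) b4) !rcons_uniq u3 n3 n4.
have link i a k l : i < 5 -> a \in take i bs -> k < 3 -> l < 3 ->
    nth 1 bs i * label u v k = a * label u v l ->
    exists c j d, [/\ c < 3, j < i, d < 3
      & nth 1 bs i * label u v c = nth 1 bs j * label u v d].
  move=> i5 ai kl ll E; exists k, (index a (take i bs)), l.
  have ji : index a (take i bs) < i.
    by rewrite -[X in _ < X](size_takel (n0 := i) (s := bs)) ?index_mem // ltnW.
  by split=> //; rewrite -(nth_take 1 ji) nth_index.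
have bound i (X : {fset G}) s : {subset take i bs <= X} -> i <= 5 -> uniq s ->
    {subset s <= products u v (nth 1 bs) i} -> size s <= #|` prodset X C|.
  move=> sX i5 us sP; apply: (uniq_leq_size us) => z /sP/productsP[j [c [ji c3' ->]]].
  apply: mem_prodset; last by apply/mem_tripleP; exists c.
  apply: sX; rewrite -(nth_take 1 ji); apply: mem_nth.
  by rewrite size_takel.
(* The link between the first two vertices is a shared point, whence 3 + 3 - 1. *)
have h2 : #|` prodset [fset b0; b1] C| <= 5.
  rewrite prodsetUl cardfsU !card_prodset1l cC.
  apply: (@leq_sub2l (3 + 3) 1%N).
  rewrite cardfs_gt0; apply/fset0Pn; exists (b1 * label u v k1).
  rewrite in_fsetI {1}E1; apply/andP; split; apply: mem_prodset; rewrite ?fset11 //.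
    by apply/mem_tripleP; exists l1.
  by apply/mem_tripleP; exists k1.
apply: (@no_small_configuration G u v (nth 1 bs)).
- by move=> s t sR; exact: exceptional_template (exceptional_relabel ex sR).
- by move=> s t sR; exact: exceptional_pair (exceptional_relabel ex sR).
- exact: exceptional_label_inj.
- by move=> i j; rewrite !inE => i5 j5 /eqP; rewrite nth_uniq // => /eqP.
- move=> [|[|[|[|[|i]]]]] // _.
  + by apply: (link _ b0 k1 l1); rewrite ?inE.
  + by apply: (link _ a2 k2 l2) => //; move: A2; rewrite !inE.
  + by apply: (link _ a3 k3 l3) => //; exact: X3E.
  + by apply: (link _ a4 k4 l4) => //; exact: X4E.
- move=> i s /andP[i0 i5] us sP.
  case: i i0 i5 sP => [|[|[|[|[|[|i]]]]]] // _ _ sP.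
  + rewrite -[nth _ _ _]cC -(card_prodset1l b0 C).
    by apply: bound sP => // b; rewrite !inE.
  + apply: leq_trans h2; apply: bound sP => // b; by rewrite !inE.
  + have -> : nth 0%N [:: 0; 3; 5; 7; 8; 9]%N 3 = (#|` X3| + 4)%N by rewrite c3.
    by apply: leq_trans h3; apply: bound sP.
  + have -> : nth 0%N [:: 0; 3; 5; 7; 8; 9]%N 4 = (#|` X4| + 4)%N by rewrite c4.
    apply: leq_trans h4; apply: bound sP => // b.
    rewrite (mem_rcons [:: b0; b1; b2] b3) in_cons => /orP[/eqP->//|/X3b].
    exact: (fsubsetP s3).
  + have -> : nth 0%N [:: 0; 3; 5; 7; 8; 9]%N 5 = (#|` X5| + 4)%N by rewrite c5.
    apply: leq_trans h5; apply: bound sP => // b.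
    rewrite (mem_rcons (rcons [:: b0; b1; b2] b3) b4) in_cons => /orP[/eqP->//|].
    move=> H; apply: (fsubsetP s4); move: H.
    rewrite (mem_rcons [:: b0; b1; b2] b3) in_cons => /orP[/eqP->//|/X3b].
    exact: (fsubsetP s3).
Qed.

End ThreeSets.

(** * Larger sets *)

Section Generated.
Variable G : groupType.
Local Open Scope group_scope.
Local Open Scope fset_scope.
Implicit Types (C D : {fset G}) (x y : G).

Lemma generated_subgroup D : subgroup (generated D).
Proof.
split.
- by move=> H [].
- by move=> x y Hx Hy H sH DH; case: (sH) => _ HM _; apply: HM; [exact: Hx|exact: Hy].
- by move=> x Hx H sH DH; case: (sH) => _ _; apply; exact: Hx.
Qed.

Lemma mem_generated D x : x \in D -> generated D x.
Proof. by move=> Dx H _; apply. Qed.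

Lemma centralizer_subgroup x : subgroup (commute x).
Proof.
split; [exact: commute1 | move=> y z; exact: commuteM | move=> y; exact: commuteV].
Qed.

Lemma generated_abelian D : {in D &, forall x y, commute x y} ->
  abelian_pred (generated D).
Proof.
move=> cD x y Dx Dy; apply: Dy (centralizer_subgroup x) _ => d Dd.
by apply/commute_sym; apply: Dx (centralizer_subgroup d) _ => d' Dd'; exact: cD.
Qed.

End Generated.

(** * Induction on the size of [C] *)

Section AffineNonabelian.
Variable G : groupType.
Hypothesis HG : unique_product_group G.
Local Open Scope group_scope.
Local Open Scope fset_scope.
Implicit Types (B C D X Y : {fset G}) (d e x y : G).

(* Invariant under right translation of C. *)
Definition affine_nonabelian C :=
  exists d a b, [/\ d \in C, a \in C, b \in C & ~ commute (a * d^-1) (b * d^-1)].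

(** Since z d'^-1 = (z d^-1)(d' d^-1)^-1, ratios to any other base point commute as soon as the
    ratios to [d] do. *)
Lemma translate_nonabelian C d :
  {in prodset C [fset d^-1] &, forall x y, commute x y} -> ~ affine_nonabelian C.
Proof.
move=> cD [d' [a [b [Cd' Ca Cb nab]]]]; apply: nab.
have T z : z \in C -> z * d^-1 \in prodset C [fset d^-1].
  by move=> Cz; apply: mem_prodset => //; rewrite fset11.
have E z : z * d'^-1 = z * d^-1 * (d' * d^-1)^-1 by rewrite invgM invgK mulgA mulgVK.
have cc z z' : z \in C -> z' \in C ->
    commute (z * d^-1) (z' * d^-1 * (d' * d^-1)^-1).
  by move=> Cz Cz'; apply: commuteM; [|apply: commuteV]; apply: cD; exact: T.
rewrite (E a) (E b); apply/commute_sym/commuteM; apply/commute_sym.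
  exact: cc.
by apply/commute_sym/commuteV/commute_sym; exact: cc.
Qed.

Lemma card_ge_three B C : affine_nonabelian C -> 7 <= #|` B| ->
  3 <= #|` C| /\ #|` B| + 5 <= #|` prodset B C|.
Proof.
move=> [d [a [b [Cd Ca Cb nab]]]] B7.
pose u := a * d^-1; pose v := b * d^-1.
have nex : ~ exceptional u v by exact: not_exceptional.
have le : #|` B| + 5 <= #|` prodset B [fset 1; u; v]|.
  by rewrite leqNgt; apply/negP => lt; apply: nex; split=> //; exists B.
have sC : prodset [fset 1; u; v] [fset d] `<=` C.
  apply/fsubsetP => _ /prodsetP[z [_ [+ /fset1P-> ->]]].
  by rewrite !inE => /orP[/orP[]|] /eqP->; rewrite ?mul1g ?mulgVK.
have c3 : #|` [fset 1; u; v]| = 3.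
  have u1 : u != 1 by apply/eqP => E; apply: nab; rewrite -/u E; exact/commute_sym/commute1.
  have v1 : v != 1 by apply/eqP => E; apply: nab; rewrite -/v E; exact/commute1.
  have uv : u != v by apply/eqP => E; apply: nab; rewrite -/u E; exact/commute_refl.
  by rewrite -!fsetUA !cardfsU1 cardfs1 !inE negb_or !(eq_sym 1) u1 v1 uv.
split.
  by have := fsubset_leq_card sC; rewrite card_prodset1r c3.
apply: leq_trans le _; rewrite -(card_prodset1r (prodset B _) d) prodsetA.
exact/fsubset_leq_card/prodsetS.
Qed.

(** Shrinking [X] to {g, k} leaves two points in the intersection of gD and kD, so q = k^-1 g maps
    two elements of [D] into [D]. If neither were the image of the other, [D] would have four
    elements. *)
Lemma three_progression D X : 2 <= #|` X| -> #|` D| = 3 ->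
  #|` prodset X D| <= #|` X| + 2 ->
  exists q d, q != 1 /\ D = [fset d; q * d; q * q * d].
Proof.
move=> X2 D3 le; have D0 : D != fset0 by rewrite -cardfs_gt0 D3.
have [Z _ [cZ leZ]] := shrink_left HG D0 X2.
have /fset0Pn[g Zg] : Z != fset0 by rewrite -cardfs_gt0 cZ.
have := cardfsD1 g Z; rewrite Zg cZ => /(congr1 predn)/= /esym/eqP/cardfs1P[k E].
have : k \in Z `\ g by rewrite E fset11.
rewrite in_fsetD1 => /andP[kg Zk].
have ZE : Z = [fset g; k] by rewrite -(fsetD1K Zg) E.
have := cardfsUI (prodset [fset g] D) (prodset [fset k] D).
rewrite -prodsetUl -ZE !card_prodset1l D3; set I := _ `&` _ => UI.
have I2 : 2 <= #|` I| by lia.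
have /fset0Pn[z1 I1] : I != fset0 by rewrite -cardfs_gt0; lia.
have /fset0Pn[z2] : I `\ z1 != fset0.
  by rewrite -cardfs_gt0; have := cardfsD1 z1 I; rewrite I1; lia.
rewrite in_fsetD1 => /andP[z21 {}I2].
pose q := k^-1 * g.
have q1 : q != 1 by rewrite /q mulg_eq1 eqg_inv.
have inI z : z \in I -> exists2 x, x \in D & q * x \in D /\ z = g * x.
  move=> /fsetIP[/prodsetP[_ [x [/fset1P-> Dx ->]]]].
  move=> /prodsetP[_ [y [/fset1P-> Dy Exy]]]; exists x => //.
  by rewrite /q -mulgA Exy mulKg.
have [d1 Dd1 [Dq1 E1]] := inI _ I1; have [d2 Dd2 [Dq2 E2]] := inI _ I2.
have d12 : d2 != d1 by apply: contra z21; rewrite E1 E2 => /eqP->.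
have qx x : q * x != x by rewrite -[X in _ != X]mul1g (inj_eq (mulIg x)).
have qqx x : q * q * x != x.
  rewrite -[X in _ != X]mul1g (inj_eq (mulIg x)); apply: contra q1 => /eqP qq.
  by apply/eqP; apply: (torsion_free HG (isT : 0 < 2)).
have prog x : x \in D -> q * x \in D -> q * q * x \in D ->
    D = [fset x; q * x; q * q * x].
  move=> Dx Dqx Dqqx; apply/esym/eqP; rewrite eqEfcard !fsubUset !fsub1set Dx Dqx Dqqx /=.
  rewrite D3 -!fsetUA !cardfsU1 cardfs1 !inE negb_or !(eq_sym x) qx qqx /=.
  by have -> : q * x != q * q * x by rewrite -(mulgA q q x) eq_sym qx.
have [e12|n12] := eqVneq (q * d1) d2.
  by exists q, d1; split=> //; apply: prog; rewrite // -(mulgA q q) e12.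
have [e21|n21] := eqVneq (q * d2) d1.
  by exists q, d2; split=> //; apply: prog; rewrite // -(mulgA q q) e21.
have : #|` [fset d1; d2; q * d1; q * d2]| <= 3.
  rewrite -D3; apply: fsubset_leq_card.
  by rewrite !fsubUset !fsub1set Dd1 Dd2 Dq1 Dq2.
rewrite -!fsetUA !cardfsU1 cardfs1 !inE !negb_or (eq_sym d1) d12 (eq_sym d1) qx.
rewrite (eq_sym d1) n21 (eq_sym d2) n12 (eq_sym d2) qx (inj_eq (mulgI q)).
by rewrite (eq_sym d1) d12.
Qed.

(** [D] is a progression of ratio [q], so XD is a translate of X{1, q}{1, q} and xq lies in [X] for
    all but at most one x in [X]. Some such x has both xe and xqe in YD, and their quotient e^-1 q e
    then lies in <q>. *)
Lemma coset_pair_conj D X Y e : 1 \in D -> #|` D| = 3 -> 4 <= #|` X| ->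
  #|` prodset X D| <= #|` X| + 2 ->
  {in Y &, forall y y', generated D (y^-1 * y')} ->
  #|` [fset x in X | x * e \notin prodset Y D]| <= 1 ->
  exists q, (forall d, d \in D -> cyclic_gen q d) /\ cyclic_gen q (e^-1 * q * e).
Proof.
move=> D1 D3 X4 le cY few.
have [q [d [q1 DE]]] := three_progression (ltac:(lia) : 2 <= #|` X|) D3 le.
have sq := cyclic_gen_subgroup q; have [_ qM qV] := sq.
have qd : cyclic_gen q d.
  have q2 : cyclic_gen q (q * q) by exact: (cyclic_genX q 2).
  have q_1 : cyclic_gen q q by exact: (cyclic_genX q 1%N).
  have inv z : 1 = z * d -> d = z^-1 by move/esym/mulg1_eq->.
  move: D1; rewrite DE !inE => /orP[/orP[]|] /eqP.
  - by move=> <-; exact: (cyclic_genX q 0).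
  - by move/inv->; exact: qV.
  - by move/inv->; exact: qV.
have qD x : x \in D -> cyclic_gen q x.
  rewrite DE !inE => /orP[/orP[]|] /eqP-> //; apply: qM => //.
    exact: (cyclic_genX q 1%N).
  exact: (cyclic_genX q 2).
exists q; split=> //.
have c2 : #|` [fset 1; q]| = 2 by rewrite cardfs2 eq_sym q1.
have n2 : [fset 1; q] != fset0 by rewrite -cardfs_gt0 c2.
have X0 : X != fset0 by rewrite -cardfs_gt0; lia.
pose Z := prodset X [fset 1; q].
have XZ : X `<=` Z.
  by apply/fsubsetP => x Xx; rewrite -[x]mulg1; apply: mem_prodset => //; rewrite !inE eqxx.
have leZ : #|` Z| <= #|` X| + 1.
  have Z0 : Z != fset0.
    by case/fset0Pn: X0 => x Xx; apply/fset0Pn; exists x; exact: (fsubsetP XZ).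
  have := card_prodset_ge HG Z0 n2; rewrite c2.
  suff : #|` prodset Z [fset 1; q]| <= #|` prodset X D| by lia.
  rewrite -(card_prodset1r _ d) /Z !prodsetA; apply/fsubset_leq_card/prodsetS => //.
  apply/fsubsetP => _ /prodsetP[a [_ [Ha /prodsetP[b [_ [Hb /fset1P-> ->]]] ->]]].
  move: Ha Hb; rewrite DE !inE => /orP[]/eqP-> /orP[]/eqP->;
    by rewrite ?mul1g ?mulgA eqxx ?orbT.
pose L := [fset x in X | x * q \in X].
pose W := [fset x in X | x * e \notin prodset Y D].
have cL : #|` X| <= #|` L| + 1.
  have sub : prodset (X `\` L) [fset q] `<=` Z `\` X.
    apply/fsubsetP => _ /prodsetP[x [_ [/fsetDP[Xx nL] /fset1P-> ->]]].
    apply/fsetDP; split; first by apply: mem_prodset => //; rewrite !inE eqxx orbT.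
    by apply: contra nL => Xq; rewrite !inE /= Xx.
  have sLX : L `<=` X by apply/fsubsetP => x; rewrite !inE => /andP[].
  by have := fsubset_leq_card sub; rewrite card_prodset1r !cardfsDS //; lia.
(* [L] has at least 3 elements, and the at most one element of [W] excludes at most 2. *)
have /fset0Pn[x] : L `\` (W `|` prodset W [fset q^-1]) != fset0.
  rewrite -cardfs_gt0; have := cardfsID (W `|` prodset W [fset q^-1]) L.
  have : #|` L `&` (W `|` prodset W [fset q^-1])| <= #|` W `|` prodset W [fset q^-1]|.
    by apply: fsubset_leq_card; exact: fsubsetIr.
  have := cardfsUI W (prodset W [fset q^-1]); rewrite card_prodset1r.
  by move: few; rewrite -/W; lia.
move=> /fsetDP[Lx]; rewrite in_fsetU negb_or => /andP[nW nW'].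
have /andP[Xx Xq] : (x \in X) && (x * q \in X) by move: Lx; rewrite !inE.
have hit z : z \in X -> z \notin W -> exists y a, [/\ y \in Y, a \in D & z * e = y * a].
  by move=> Xz; rewrite !inE /= Xz negbK => /prodsetP.
have [y [a [Yy Da E]]] := hit x Xx nW.
have [|y' [a' [Yy' Da' E']]] := hit _ Xq.
  apply: contra nW' => H; apply/prodsetP; exists (x * q), q^-1.
  by rewrite H fset11 mulgK.
have -> : e^-1 * q * e = (x * e)^-1 * (x * q * e).
  by rewrite invgM -!mulgA mulKg.
rewrite E E' invgM -mulgA; apply: (qM); first exact/qV/qD.
rewrite mulgA; apply: (qM); last exact: qD.
exact: cY sq qD.
Qed.

(** [X] is the part of [Z] in one left coset of [H] and [Y] is the rest. Right multiplication by [D]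
    stays within each coset, so the two product sets are disjoint. *)
Lemma coset_decomposition (H : G -> Prop) D Z : subgroup H ->
  (forall d, d \in D -> H d) -> ~ {in Z &, forall x y, H (x^-1 * y)} ->
  exists X Y, [/\ X != fset0, Y != fset0, #|` Z| = (#|` X| + #|` Y|)%N,
    {in X &, forall x y, H (x^-1 * y)} & X `|` Y = Z /\
    #|` prodset Z D| = (#|` prodset X D| + #|` prodset Y D|)%N].
Proof.
move=> [H1 HM HV] DH nZ.
have [x0 [y0 [Zx0 Zy0 nH]]] : exists x0 y0, [/\ x0 \in Z, y0 \in Z & ~ H (x0^-1 * y0)].
  apply: contrapT => N; apply: nZ => x y Zx Zy; apply: contrapT => nH.
  by apply: N; exists x, y.
pose X : {fset G} := [fset y in Z | `[< H (x0^-1 * y) >]]; pose Y := Z `\` X.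
have XP x : x \in X -> x \in Z /\ H (x0^-1 * x).
  by rewrite !inE /= => /andP[Zx /asboolP].
have YP y : y \in Y -> y \in Z /\ ~ H (x0^-1 * y).
  by move=> /fsetDP[Zy nX]; split=> // Hy; move: nX; rewrite !inE /= Zy => /asboolP.
have sXZ : X `<=` Z by apply/fsubsetP => x /XP[].
have XYZ : X `|` Y = Z by rewrite -[RHS](fsetID X Z) (fsetIidPr sXZ).
exists X, Y; split.
- by apply/fset0Pn; exists x0; rewrite !inE /= Zx0 mulVg; apply/asboolP.
- by apply/fset0Pn; exists y0; rewrite in_fsetD Zy0 andbT !inE /= Zy0; apply/asboolP.
- by have := cardfsID X Z; rewrite (fsetIidPr sXZ).
- move=> x y /XP[_ Hx] /XP[_ Hy].
  by have := HM _ _ (HV _ Hx) Hy; rewrite invgM invgK mulgA mulgK.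
split=> //; rewrite -XYZ prodsetUl card_fsetU_disjoint // => z.
move=> /prodsetP[x [d [/XP[_ Hx] Dd ->]]]; apply/negP.
move=> /prodsetP[y [d' [/YP[_ nHy] Dd' E]]]; apply: nHy.
suff -> : x0^-1 * y = x0^-1 * x * d * d'^-1.
  by apply: (HM); [apply: (HM) => //; exact: DH | exact/HV/DH].
by apply: (mulIg d'); rewrite mulgVK -!mulgA E.
Qed.

Lemma affine_nonabelian_card_ge7 n B C : #|` C| = n -> affine_nonabelian C ->
  #|` B| = 7 -> #|` B| + #|` C| + 2 <= #|` prodset B C|.
Proof.
elim: n B C => [|n IH] B C cC naC B7.
  by have [] := card_ge_three naC (eq_leq (esym B7)); rewrite cC.
have [C3 ge5] := card_ge_three naC (eq_leq (esym B7)).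
have [n3|n3] := leqP n 2; first by lia.
rewrite leqNgt; apply/negP => lt.
have B0 : B != fset0 by rewrite -cardfs_gt0 B7.
have C0 : C != fset0 by rewrite -cardfs_gt0 cC.
have [b0 [c [Bb0 Cc _ uniqc]]] := unique_product HG B0 C0.
pose C' := C `\ c.
have cC' : #|` C'| = n by have := cardfsD1 c C; rewrite Cc cC => -[].
have ltC' : #|` prodset B C'| < #|` prodset B C|.
  rewrite (cardfsD1 (b0 * c) (prodset B C)) mem_prodset //= add1n ltnS.
  apply/fsubset_leq_card; rewrite fsubsetD1 uniqc andbT.
  by apply: prodsetS => //; exact: fsubD1set.
(* If [C'] is still nonabelian, induction suffices, since deleting [c] lost a product. *)
have [naC'|abC'] := EM (affine_nonabelian C').
  by have := IH B C' cC' naC' B7; lia.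
have /fset0Pn[d C'd] : C' != fset0 by rewrite -cardfs_gt0 cC'; lia.
pose D := prodset C' [fset d^-1]; pose e := c * d^-1.
have cD : #|` D| = n by rewrite card_prodset1r.
have D1 : 1 \in D by apply/prodsetP; exists d, d^-1; rewrite C'd fset11 mulgV.
have D0 : D != fset0 by apply/fset0Pn; exists 1.
have comD : {in D &, forall x y, commute x y}.
  move=> _ _ /prodsetP[x [_ [Cx /fset1P-> ->]]] /prodsetP[y [_ [Cy /fset1P-> ->]]].
  by apply: contrapT => nxy; apply: abC'; exists d, x, y.
have CE : prodset C [fset d^-1] = D `|` [fset e].
  rewrite -(fsetD1K Cc) -/C' fsetUC prodsetUl; congr (_ `|` _).
  apply/fsetP => z; rewrite in_fset1; apply/prodsetP/eqP => [|->].
    by move=> [_ [_ [/fset1P-> /fset1P-> ->]]].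
  by exists c, d^-1; rewrite !fset11.
have ncom : ~ {in D, forall x, commute e x}.
  move=> eD; apply: (translate_nonabelian (d := d)) naC; rewrite CE => x y.
  case/fsetUP => [Dx|/fset1P->] /fsetUP[Dy|/fset1P->].
  - exact: comD.
  - by apply/commute_sym; exact: eD.
  - exact: eD.
  - exact: commute_refl.
pose H := generated D.
have sH : subgroup H := generated_subgroup D; have [_ HM HV] := sH.
have DH x : x \in D -> H x := @mem_generated _ D x.
have eH : ~ H e.
  by move=> He; apply: ncom => x Dx; apply: (generated_abelian comD) => //; exact: DH.
have BCE : #|` prodset B C| = #|` prodset B (D `|` [fset e])|.
  by rewrite -CE -prodsetA card_prodset1r.
have BC'E : #|` prodset B C'| = #|` prodset B D| by rewrite -prodsetA card_prodset1r.
have BeE : #|` prodset B (D `|` [fset e])| =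
    (#|` prodset B D| + #|` prodset B [fset e] `\` prodset B D|)%N.
  rewrite prodsetUr -card_fsetU_disjoint; last first.
    by move=> z Dz; rewrite in_fsetD Dz.
  by congr #|` _|; apply/fsetP => z; rewrite !inE; case: (z \in prodset B D).
have leBe : #|` prodset B D| + #|` prodset B [fset e] `\` prodset B D| <= n + 9.
  by rewrite -BeE -BCE; clear -lt B7 cC; lia.
have leBD : #|` prodset B D| <= n + 8.
  by rewrite -BC'E; clear -ltC' lt B7 cC; lia.
have Kem (Z : {fset G}) : Z != fset0 -> #|` Z| + n <= #|` prodset Z D| + 1.
  by move=> Z0; have := card_prodset_ge HG Z0 D0; rewrite cD.
(* If [B] lies in one coset, Be avoids BD because [e] is outside [H]: at least (n + 6) + 7 products,
   against n + 9. *)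
have [one|] := EM {in B &, forall x y, H (x^-1 * y)}.
  have := Kem B B0; suff : #|` prodset B [fset e] `\` prodset B D| = 7.
    by clear -leBe B7; lia.
  rewrite -B7 -(card_prodset1r B e); congr #|` _|; apply/fsetDidPl/fdisjointP.
  move=> _ /prodsetP[x [_ [Bx /fset1P-> ->]]]; apply/negP.
  move=> /prodsetP[y [z [By Dz E]]]; apply: eH.
  by rewrite -(mulKg x e) E mulgA; apply: HM; [exact: one|exact: DH].
move=> /(coset_decomposition sH DH)[X [Y [X0 Y0 cXY cosetX [XYB spl]]]].
have KX := Kem _ X0; have KY := Kem _ Y0.
(* Two parts give |BD| >= 7 + 2(n - 1), against n + 8. A third coset would then give 13 products,
   against 11. *)
have n3' : n = 3 by clear -KX KY spl cXY leBD B7 n3; lia.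
have cosetY : {in Y &, forall x y, H (x^-1 * y)}.
  apply: contrapT => /(coset_decomposition sH DH)[Y1 [Y2 [Y10 Y20 cY _ [_ spl']]]].
  have := Kem _ Y10; have := Kem _ Y20.
  by clear -KX KY spl spl' cXY cY leBD B7 n3'; lia.
(* Of the at most 12 products, BD takes at least 11, leaving at most one element of Be outside
   it. *)
have few (Z Z' : {fset G}) : Z `|` Z' = B -> {in Z &, forall x y, H (x^-1 * y)} ->
    #|` [fset x in Z | x * e \notin prodset Z' D]| <= 1.
  move=> ZB cZ; apply: (@leq_trans #|` prodset B [fset e] `\` prodset B D|); last first.
    by clear -KX KY spl cXY leBe B7 n3'; lia.
  rewrite -(card_prodset1r _ e); apply/fsubset_leq_card/fsubsetP.
  move=> _ /prodsetP[x [_ [Wx /fset1P-> ->]]].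
  have /andP[Zx nx] : (x \in Z) && (x * e \notin prodset Z' D).
    by move: Wx; rewrite !inE.
  apply/fsetDP; split.
    by apply: mem_prodset; rewrite ?fset11 // -ZB in_fsetU Zx.
  rewrite -ZB prodsetUl in_fsetU negb_or nx andbT; apply/negP.
  move=> /prodsetP[y [z [Zy Dz E]]]; apply: eH.
  by rewrite -(mulKg x e) E mulgA; apply: HM; [exact: cZ|exact: DH].
have [q [qD qe]] : exists q, (forall d, d \in D -> cyclic_gen q d)
    /\ cyclic_gen q (e^-1 * q * e).
  have D3 : #|` D| = 3 by rewrite cD.
  (* One of the two parts of the 7 elements has at least 4. *)
  have [X4|X4] := leqP 4 #|` X|.
    apply: (coset_pair_conj (X := X) (Y := Y)) => //; last exact: few.
    by clear -KX KY spl cXY leBD B7 n3'; lia.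
  apply: (coset_pair_conj (X := Y) (Y := X)) => //.
  - by clear -X4 cXY B7; lia.
  - by clear -KX KY spl cXY leBD B7 n3'; lia.
  - by apply: few => //; rewrite fsetUC.
have neq : ~ commute e q.
  move=> ceq; apply: ncom => x /qD[m [k ->]].
  by apply: commuteM; [|apply: commuteV]; exact: commuteX.
have D2 : 2 <= #|` D| by rewrite cD n3'.
have := cyclic_conj_card_ge HG neq (or_introl qe) qD D2 (eq_leq (esym B7)).
by rewrite -BCE -CE card_prodset1r leqNgt lt.
Qed.

Theorem affine_nonabelian_card_ge B C : affine_nonabelian C -> 7 <= #|` B| ->
  #|` B| + #|` C| + 2 <= #|` prodset B C|.
Proof.
move=> naC B7.
have C0 : C != fset0 by case: naC => d [_ [_ [Cd _ _ _]]]; apply/fset0Pn; exists d.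
have [X _ [cX le]] := shrink_left HG C0 B7.
by have := affine_nonabelian_card_ge7 erefl naC cX; lia.
Qed.

End AffineNonabelian.

Theorem theorem1p1 (G : groupType) (HG : unique_product_group G)
  (C : {fset G}) (C1 : (1%g : G) \in C)
  (HC : ~ abelian_pred (generated C)) (B : {fset G}) (HB : 7 <= #|` B|) :
  #|` B| + #|` C| + 2 <= #|` prodset B C|.
Proof.
apply: affine_nonabelian_card_ge => //; apply: contrapT => abC; apply: HC.
apply: generated_abelian => a b Ca Cb; apply: contrapT => nab; apply: abC.
by exists 1%g, a, b; split; rewrite ?invg1 ?mulg1.
Qed.
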